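(* Let $\mathcal{P}$ be a non-trivial hereditary property of graphs and let $k=k(\mathcal{P})\geq 2$ denote the minimum chromatic number of a graph that does not belong to $\mathcal{P}$. Then, for every fixed $p\in(0,1)$, the random graph $G=G(n,p)$ satisfies, with high probability, $$\mathrm{ex}(G,\mathcal{P})=\left(1-\frac{1}{k-1}+o(1)\right)p\binom{n}{2},$$ where the $o(1)$-term tends to $0$ as $n\to\infty$.
   Context: A property of graphs is a family of graphs closed under isomorphism; it is hereditary if it is closed under taking induced subgraphs. It is non-trivial if it contains all edgeless graphs and does not contain some graph. For a graph $G$, $\mathrm{ex}(G,\mathcal{P})$ denotes the maximum number of edges of a subgraph of $G$ that belongs to $\mathcal{P}$. $G(n,p)$ is the binomial random graph on $n$ vertices in which each pair is an edge independently with probability $p$. ''With high probability'' means with probability tending to $1$ as $n\to\infty$. *)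

(* Defs.v *)
From HB Require Import structures.
From mathcomp Require Import all_boot all_order all_algebra.
From mathcomp Require Import all_classical all_reals all_analysis.

Set Implicit Arguments.
Unset Strict Implicit.
Unset Printing Implicit Defensive.

Import Order.TTheory GRing.Theory Num.Theory.
Import numFieldNormedType.Exports.

Local Open Scope ring_scope.

(** Finite simple graphs on the vertex set [T], given by their set of edges;
    an edge is a two-element set of vertices. *)
Record sgraph (T : finType) := SGraph {
  edges : {set {set T}};
  _ : [forall e in edges, #|e| == 2%N] }.

HB.instance Definition _ (T : finType) := [isSub for @edges T].
HB.instance Definition _ (T : finType) := [Countable of sgraph T by <:].
HB.instance Definition _ (T : finType) := [Finite of sgraph T by <:].

Lemma card_edge (T : finType) (G : sgraph T) (e : {set T}) :
  e \in edges G -> #|e| = 2%N.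
Proof. by move=> eG; apply/eqP; move/forall_inP: (valP G); apply. Qed.

(** [adj G x y] forces [x != y], since [[set x; x]] has only one element. *)
Definition adj (T : finType) (G : sgraph T) : rel T :=
  [rel x y | [set x; y] \in edges G].

Lemma adj_neq (T : finType) (G : sgraph T) (x y : T) : adj G x y -> x != y.
Proof. by rewrite /adj /= => /card_edge; rewrite cards2; case: (x != y). Qed.

Definition isomorphic (T U : finType) (G : sgraph T) (H : sgraph U) : Prop :=
  exists2 f : T -> U, bijective f & forall x y, adj G x y = adj H (f x) (f y).

Definition subvert (T : finType) (W : {set T}) : finType := {x : T | x \in W}.

Definition induced_edges (T : finType) (G : sgraph T) (W : {set T}) :
    {set {set subvert W}} :=
  [set e : {set subvert W} | [set val x | x in e] \in edges G].

Lemma induced_subproof (T : finType) (G : sgraph T) (W : {set T}) :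
  [forall e in induced_edges G W, #|e| == 2%N].
Proof.
apply/forall_inP => e; rewrite inE => /card_edge.
by rewrite card_imset => [->|]; last exact: val_inj.
Qed.

Definition induced (T : finType) (G : sgraph T) (W : {set T}) :
  sgraph (subvert W) := SGraph (induced_subproof G W).

(** [H], a graph on the vertex subset [W] of [T], is a (not necessarily induced)
    subgraph of [G]. *)
Definition subgraph (T : finType) (G : sgraph T) (W : {set T})
    (H : sgraph (subvert W)) : bool :=
  [forall e in edges H, [set val x | x in e] \in edges G].

Definition graph_family := forall T : finType, sgraph T -> Prop.

Definition graph_property (P : graph_family) : Prop :=
  forall (T U : finType) (G : sgraph T) (H : sgraph U),
    isomorphic G H -> P T G -> P U H.

Definition hereditary (P : graph_family) : Prop :=
  forall (T : finType) (G : sgraph T) (W : {set T}),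
    P T G -> P (subvert W) (induced G W).

Definition nontrivial (P : graph_family) : Prop :=
  (forall (T : finType) (G : sgraph T), edges G = finset.set0 -> P T G) /\
  (exists (T : finType) (G : sgraph T), ~ P T G).

Definition colorable (T : finType) (G : sgraph T) (k : nat) : bool :=
  [exists c : {ffun T -> 'I_k}, [forall x, forall y, adj G x y ==> (c x != c y)]].

Lemma colorable_ex (T : finType) (G : sgraph T) : exists k, colorable G k.
Proof.
exists #|T|; apply/existsP; exists [ffun x => enum_rank x].
apply/forallP => x; apply/forallP => y; apply/implyP => /adj_neq.
by rewrite !ffunE (inj_eq enum_rank_inj).
Qed.

Definition chromatic_number (T : finType) (G : sgraph T) : nat :=
  ex_minn (colorable_ex G).

Definition min_excluded_chromatic (P : graph_family) (k : nat) : Prop :=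
  (exists (T : finType) (G : sgraph T), ~ P T G /\ chromatic_number G = k) /\
  (forall (T : finType) (G : sgraph T), ~ P T G -> (k <= chromatic_number G)%N).

Lemma min_excluded_chromatic_exists (P : graph_family)   :
  nontrivial P -> exists k, min_excluded_chromatic P k.
Proof.
move=> [_ [T [G nG]]].
have h : exists k, `[< exists (T : finType) (G : sgraph T), ~ P T G /\ chromatic_number G = k >].
  by exists (chromatic_number G); apply/asboolP; exists T, G.
case: (ex_minnP h) => k /asboolP hk hm; exists k; split=> // U H nH.
by apply: hm; apply/asboolP; exists U, H.
Qed.

(** The subgraphs range over all vertex subsets [W], not only spanning ones: a
    hereditary property need not be stable under adding isolated vertices. *)
Definition ex (P : graph_family) (T : finType) (G : sgraph T) : nat :=
  \max_(W : {set T})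
    \max_(H : sgraph (subvert W) | subgraph G H && `[< P (subvert W) H >])
      #|edges H|.

(** Law of the binomial random graph: the product, over all unordered pairs of
    vertices, of the Bernoulli([p]) laws of the edge indicators. *)
Definition gnp (R : realType) (n : nat) (p : R) (G : sgraph 'I_n) : R :=
  \prod_(e : {set 'I_n} | #|e| == 2%N) (if e \in edges G then p else 1 - p).

Definition gnp_prob (R : realType) (n : nat) (p : R) (A : sgraph 'I_n -> Prop) : R :=
  \sum_(G : sgraph 'I_n | `[< A G >]) gnp p G.

Definition whp (R : realType) (p : R) (A : forall n, sgraph 'I_n -> Prop) : Prop :=
  ((fun n => gnp_prob p (A n)) @ \oo --> (1 : R))%classic.

(* Main.v *)
Require Import Defs.
From HB Require Import structures.
From mathcomp Require Import all_boot all_order all_algebra.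
From mathcomp Require Import all_classical all_reals all_analysis.
From mathcomp Require Import ring lra zify.

(** The lower bound is the average (k-1)-cut of [G]. For the upper bound only
    the following pseudorandomness of [G] is used: for all vertex sets [A] and
    [B], the number of edges between them is [p |A| |B|] up to [d n^2]. It holds
    with high probability because the expected number of 4-cycles, counted with
    the centred weights [1_e - p], is [O(n^3)], and this number controls all
    cuts.

    Let [H] be a [k]-chromatic graph outside [P], and let [G'] be a subgraph of a
    pseudorandom [G] with more than [(1 - 1/(k-1) + eta) p n^2 / 2] edges.
    Averaging over the copies of [K_m] in [G], a positive fraction of them
    contain more than [(1 - 1/(k-1)) m^2 / 2] edges of [G'], hence by Turan's
    theorem a [K_k] of [G']. So [G'] contains a positive fraction of all
    [K_k], and by Cauchy-Schwarz (duplicating one vertex at a time) of all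
    homomorphic images of any [k]-partite graph, in particular of [H]. Finally
    pseudorandomness of [G] allows one to require in addition that the non-edges
    of [H] are non-edges of [G], at the cost of a factor [1 - p] each: so [G']
    contains an induced copy of [H], and does not belong to [P]. *)

Set Implicit Arguments.
Unset Strict Implicit.
Unset Printing Implicit Defensive.

Import Order.TTheory GRing.Theory Num.Theory.
Import numFieldNormedType.Exports.

Local Open Scope ring_scope.

(** * Counting maps under pseudorandom constraints *)

Definition upd (U V : finType) (x : {ffun U -> V}) (u : U) (a : V) :
  {ffun U -> V} := [ffun w => if w == u then a else x w].

(** Swapping the value at [u] with the spare value [a] is an involution on the pairs [(x, a)]. This
    resampling is how single coordinates are averaged out below. *)
Lemma sum_upd (R : pzSemiRingType) (U V : finType) (u : U)
    (F : {ffun U -> V} -> R) :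
  \sum_x \sum_a F (upd x u a) = #|V|%:R * \sum_x F x.
Proof.
rewrite mulr_sumr [RHS](_ : _ = \sum_x \sum_(a : V) F x); last first.
  by apply: eq_bigr => x _; rewrite sumr_const mulr_natl.
rewrite !pair_bigA /=.
rewrite [RHS](reindex_inj (h := fun t => (upd t.1 u t.2, t.1 u))) //=.
apply: inv_inj => -[x a] /=; congr (_, _).
  by apply/ffunP => w; rewrite !ffunE; case: eqP => // ->.
by rewrite ffunE eqxx.
Qed.

(** Cauchy-Schwarz against the constant function, obtained by summing [(F i - F j) ^+ 2 >= 0] over
    all pairs. *)
Lemma sqr_sum_le (R : realFieldType) (I : finType) (F : I -> R) :
  (\sum_i F i) ^+ 2 <= #|I|%:R * \sum_i F i ^+ 2.
Proof.
rewrite -(ler_pM2l (ltr0n _ 2)).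
have -> : 2 * (#|I|%:R * \sum_i F i ^+ 2) =
    \sum_i \sum_j (F i ^+ 2 + F j ^+ 2).
  under [RHS]eq_bigr do rewrite big_split /= sumr_const.
  by rewrite big_split /= sumr_const sumrMnl !mulr_natl mulr2n.
rewrite expr2 big_distrlr /= mulr_sumr; apply: ler_sum => i _.
rewrite mulr_sumr; apply: ler_sum => j _.
have := sqr_ge0 (F i - F j); nra.
Qed.

(** Closeness in cut norm to the constant [q]. Ordered pairs are counted, and [A] and [B] may
    overlap. *)
Definition quasirandom (R : realFieldType) (V : finType) (r : rel V) (q d : R) :=
  forall A B : {set V},
    `|\sum_(a in A) \sum_(b in B) (r a b)%:R - q * (#|A|%:R * #|B|%:R)|
      <= d * #|V|%:R ^+ 2.

Definition sat (U V : finType) (r : rel V) (L : seq (U * U))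
    (x : {ffun U -> V}) := all (fun e => r (x e.1) (x e.2)) L.

(** Distinctness as unordered pairs; one common endpoint is still allowed. *)
Definition apart (U : eqType) (e f : U * U) := (e != f) && (e != (f.2, f.1)).

(* Once all coordinates but those at [u] and [v] are fixed, [phi] becomes the
   indicator of a combinatorial rectangle. *)
Definition splits (U V : finType) (u v : U) (phi : pred {ffun U -> V}) :=
  forall x, exists A B : {set V}, forall a b,
    phi (upd (upd x u a) v b) = (a \in A) && (b \in B).

Lemma splitsI (U V : finType) (u v : U) (phi psi : pred {ffun U -> V}) :
  splits u v phi -> splits u v psi -> splits u v (fun x => phi x && psi x).
Proof.
move=> h1 h2 x; have [A [B hA]] := h1 x; have [C [D hC]] := h2 x.
by exists (A :&: C), (B :&: D) => a b; rewrite hA hC !inE andbACA.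
Qed.

(** Since [f] does not join [u] to [v], its constraint depends on the image of [u] alone or on the
    image of [v] alone, so one side of the rectangle can be taken full. *)
Lemma splits_sat1 (U V : finType) (r : rel V) (e f : U * U) :
  apart e f ->
  splits e.1 e.2 (fun x : {ffun U -> V} => r (x f.1) (x f.2)).
Proof.
case: e f => [u v] [s t] /= /andP[]; rewrite !xpair_eqE /= => n1 n2 x.
have [sv|sv] := eqVneq s v; have [tv|tv] := eqVneq t v.
- exists finset.setT, [set b | r b b] => a b.
  by rewrite !ffunE sv tv !eqxx !inE.
- exists finset.setT, [set b | r b (x t)] => a b.
  rewrite !ffunE sv eqxx (negPf tv) !inE.
  by move: n2; rewrite sv eqxx andbT eq_sym => /negPf ->.
- exists finset.setT, [set b | r (x s) b] => a b.
  rewrite !ffunE tv eqxx (negPf sv) !inE.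
  by move: n1; rewrite tv eqxx andbT eq_sym => /negPf ->.
- exists [set a | r (upd x u a s) (upd x u a t)], finset.setT => a b.
  by rewrite !ffunE (negPf sv) (negPf tv) !inE !ffunE andbT.
Qed.

Lemma splits_sat (U V : finType) (r : rel V) (e : U * U) (L : seq (U * U)) :
  all (apart e) L -> splits e.1 e.2 (@sat U V r L).
Proof.
elim: L => [|f L IH] /=.
  by move=> _ x; exists finset.setT, finset.setT => a b; rewrite !inE.
by move=> /andP[/splits_sat1 h /IH]; apply: splitsI; exact: h.
Qed.

(** Fix all coordinates but [u] and [v]: [phi] then selects a rectangle, on which the sum is exactly
    the quantity that quasirandomness bounds. Averaging over these fibres preserves the relative
    error [d]. *)
Lemma count_edge (R : realFieldType) (U V : finType) (r : rel V) (q d : R)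
    (u v : U) (phi : pred {ffun U -> V}) :
  u != v -> (0 < #|V|)%N -> quasirandom r q d -> splits u v phi ->
  `|\sum_x (phi x && r (x u) (x v))%:R - q * \sum_x (phi x)%:R|
    <= d * #|{ffun U -> V}|%:R.
Proof.
move=> uv V0 qr sp; set n : R := #|V|%:R.
have n0 : 0 < n by rewrite ltr0n.
pose F x : R := (phi x && r (x u) (x v))%:R - q * (phi x)%:R.
rewrite [X in `|X|](_ : _ = \sum_x F x); last by rewrite sumrB mulr_sumr.
have E : n * (n * \sum_x F x) =
    \sum_x \sum_a \sum_b F (upd (upd x u a) v b).
  rewrite -(sum_upd v) -/n.
  rewrite -(sum_upd u (fun x => \sum_b F (upd x v b))).
  by [].
have H : `|n * (n * \sum_x F x)| <= \sum_(x : {ffun U -> V}) d * n ^+ 2.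
  rewrite E; apply: le_trans (ler_norm_sum _ _ _) _; apply: ler_sum => x _.
  have [A [B h]] := sp x.
  apply: le_trans (qr A B); rewrite le_eqVlt; apply/orP; left; apply/eqP.
  congr `|_|.
  rewrite [X in _ - X](_ : _ = \sum_(a in A) \sum_(b in B) q); last first.
    under eq_bigr do rewrite sumr_const.
    by rewrite sumr_const -natrM mulr_natr mulnC mulrnA.
  rewrite -sumrB [RHS]big_mkcond; apply: eq_bigr => a _.
  rewrite -sumrB; case: ifPn => aA; last first.
    by apply: big1 => b _; rewrite /F !h (negPf aA) /= mulr0 subr0.
  rewrite [RHS]big_mkcond; apply: eq_bigr => b _.
  rewrite /F h aA /= !ffunE !eqxx (negPf uv).
  by case: (b \in B) => /=; rewrite ?mulr1 // mulr0 subr0.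
have : n ^+ 2 * `|\sum_x F x| <= n ^+ 2 * (d * #|{ffun U -> V}|%:R).
  move: H; rewrite mulrA -expr2 normrM [`|n ^+ 2|]ger0_norm ?sqr_ge0 //.
  by rewrite sumr_const -[X in _ <= X -> _]mulr_natr (mulrC d) -(mulrA _ d).
by rewrite ler_pM2l // exprn_gt0.
Qed.

(** The pairs of [L'] are peeled off one at a time: the remaining constraints split at the removed
    pair. Each removal costs [d], and earlier errors are only multiplied by [q <= 1]. The
    constraints of an arbitrary relation [g] on [L] ride along. *)
Lemma count_edges (R : realFieldType) (U V : finType) (g r : rel V) (q d : R)
    (L L' : seq (U * U)) :
  0 <= q <= 1 -> (0 < #|V|)%N -> quasirandom r q d ->
  all (fun e => e.1 != e.2) L' -> pairwise (@apart U) L' ->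
  allrel (@apart U) L' L ->
  `|\sum_(x : {ffun U -> V}) (sat g L x && sat r L' x)%:R
    - q ^+ size L' * \sum_(x : {ffun U -> V}) (sat g L x)%:R|
    <= (size L')%:R * d * #|{ffun U -> V}|%:R.
Proof.
move=> /andP[q0 q1] V0 qr; elim: L' => [|e L' IH] /=.
  move=> _ _ _; rewrite expr0 mul1r !mul0r.
  under eq_bigr do rewrite andbT.
  by rewrite subrr normr0.
move=> /andP[e12 h1] /andP[eL' h2]; rewrite allrel_consl => /andP[eL h3].
have {IH} := IH h1 h2 h3.
have := count_edge e12 V0 qr (splitsI (splits_sat g eL) (splits_sat r eL')).
set a := \sum_x _; set b := \sum_x _; set c := \sum_x _; set a' := \sum_x _.
have -> : a' = a.
  by apply: eq_bigr => x _; rewrite -andbA; congr ((_ && _)%:R); rewrite andbC.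
set N := #|_|%:R; rewrite exprS.
move=> Ha Hb.
have -> : a - q * q ^+ size L' * c = (a - q * b) + q * (b - q ^+ size L' * c).
  by ring.
apply: le_trans (ler_normD _ _) _.
rewrite -[(size L').+1]add1n natrD !mulrDl mul1r lerD //.
rewrite normrM ger0_norm //; apply: le_trans Hb.
exact: ler_piMl (normr_ge0 _) q1.
Qed.

(** * Turan's theorem and blow-ups *)

(** Induction on [r] inside the neighbourhood [N] of a vertex of maximal degree. If [N] is dense
    enough, a clique found there is extended by that vertex. Otherwise few adjacencies lie inside
    [N], and every vertex outside [N] has degree at most [#|N|], which contradicts the density of
    [W]. *)
Lemma turan (T : finType) (e : rel T) (r : nat) (W : {set T}) :
  symmetric e -> irreflexive e ->
  (r * #|W| ^ 2 < r.+1 * \sum_(x in W) \sum_(y in W) e x y)%N ->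
  exists s : seq T, [/\ size s = r.+2, {subset s <= W} & pairwise e s].
Proof.
move=> esym eirr; elim: r W => [|r IH] W.
  rewrite mul0n mul1n lt0n sum_nat_eq0 negb_forall => /existsP[x].
  rewrite negb_imply sum_nat_eq0 negb_forall => /andP[xW /existsP[y]].
  rewrite negb_imply eqb0 negbK => /andP[yW exy].
  exists [:: x; y]; split => //=; last by rewrite exy.
  by move=> z; rewrite !inE => /orP[] /eqP ->.
move=> big.
have [W0|[w wW]] := finset.set_0Vmem W.
  by move: big; rewrite W0 big_set0 muln0 ltn0.
pose deg x := (\sum_(y in W) e x y)%N.
have [v vW vmax] := arg_maxnP deg wW.
pose N := [set y in W | e v y].
have degE : deg v = #|N|.
  rewrite /deg -sum1_card big_mkcond [RHS]big_mkcond; apply: eq_bigr => y _.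
  by rewrite inE; case: (y \in W) => //=; case: (e v y).
case: (ltnP (r * #|N| ^ 2) (r.+1 * \sum_(x in N) \sum_(y in N) e x y)) => h.
  have [s [ss sN ps]] := IH _ h.
  exists (v :: s); split; first by rewrite /= ss.
  - move=> z; rewrite inE => /orP[/eqP -> //|/sN]; by rewrite inE => /andP[].
  - by rewrite /= ps andbT; apply/allP => z /sN; rewrite inE => /andP[].
exfalso; move: big; apply/negP; rewrite -leqNgt.
have NW : N \subset W by apply/fintype.subsetP => z; rewrite inE => /andP[].
have split F : (\sum_(x in W) F x = \sum_(x in N) F x + \sum_(x in W :\: N) F x)%N.
  by rewrite (big_setID N) /= (finset.setIidPr NW).
have bound F : (forall x, x \in W -> F x <= #|N|)%N ->
    (\sum_(x in W :\: N) F x <= #|W :\: N| * #|N|)%N.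
  move=> hF; rewrite -sum_nat_const; apply: leq_sum => x.
  by rewrite inE => /andP[_ /hF].
have dW x : x \in W -> (deg x <= #|N|)%N by rewrite -degE; exact: vmax.
have H1 : (\sum_(x in W :\: N) \sum_(y in W) e x y <= #|W :\: N| * #|N|)%N.
  exact: bound.
have H2 : (\sum_(x in N) \sum_(y in W :\: N) e x y <= #|W :\: N| * #|N|)%N.
  rewrite exchange_big /=; apply: bound => x xW.
  apply: leq_trans (dW x xW); rewrite /deg split.
  apply: leq_trans (leq_addr _ _); apply: leq_sum => y _.
  by rewrite esym.
have H3 : (\sum_(x in W) \sum_(y in W) e x y <=
    \sum_(x in N) \sum_(y in N) e x y + 2 * (#|W :\: N| * #|N|))%N.
  rewrite split mul2n -addnn addnA leq_add //.
  under eq_bigr do rewrite split.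
  by rewrite big_split leq_add2l.
have Wcard : #|W| = (#|N| + #|W :\: N|)%N.
  by rewrite -(cardsID N W) (finset.setIidPr NW).
move: h H3; rewrite Wcard.
move: (\sum_(x in W) _)%N (\sum_(x in N) _)%N #|N| #|W :\: N| => D E d t h H3.
have h3 : (r.+1 * D <= r * d ^ 2 + 2 * r.+1 * (t * d))%N.
  have := leq_mul (leqnn r.+1) H3; rewrite mulnDr => /leq_trans; apply.
  by rewrite leq_add // mulnCA mulnA.
(* With [d] the size of [N] and [t] that of its complement in [W], the difference of the two sides
   is the square of [r.+1 * t - d]. *)
have h4 : (r.+2 * (r * d ^ 2 + 2 * r.+1 * (t * d)) <= r.+1 ^ 2 * (d + t) ^ 2)%N.
  have := (nat_Cauchy (r.+1 * t) d).1.
  set x := (2 * (_ * d))%N => hx.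
  have -> : (r.+2 * (r * d ^ 2 + 2 * r.+1 * (t * d)) =
      r.+2 * r * d ^ 2 + r.+2 * x)%N by rewrite /x; ring.
  have -> : (r.+1 ^ 2 * (d + t) ^ 2 =
      r.+2 * r * d ^ 2 + r.+1 * x + (d ^ 2 + (r.+1 * t) ^ 2))%N.
    by rewrite /x; ring.
  by rewrite -addnA leq_add2l mulSn addnC leq_add2l addnC.
rewrite -(leq_pmul2l (ltn0Sn r)) mulnCA (leq_trans (leq_mul (leqnn _) h3)) //.
by rewrite (leq_trans h4) // -(mulnn r.+1) -mulnA.
Qed.

(** The probability of [phi] for a uniformly random map. Maps need not be injective, so the images
    of the vertices are independent. *)
Definition dens (R : realFieldType) (U V : finType) (phi : pred {ffun U -> V}) : R :=
  (\sum_x (phi x)%:R) / #|{ffun U -> V}|%:R.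

Lemma card_ffun_gt0 (U V : finType) : (0 < #|V|)%N -> (0 < #|{ffun U -> V}|)%N.
Proof. by move=> V0; rewrite card_ffun expn_gt0 V0. Qed.

Lemma dens_ge0 (R : realFieldType) (U V : finType) (phi : pred {ffun U -> V}) :
  0 <= dens R phi.
Proof. by rewrite divr_ge0 ?sumr_ge0. Qed.

Lemma le_dens (R : realFieldType) (U V : finType) (phi psi : pred {ffun U -> V}) :
  (forall x, phi x -> psi x) -> dens R phi <= dens R psi.
Proof.
move=> h; rewrite ler_wpM2r ?invr_ge0 //; apply: ler_sum => x _.
by rewrite ler_nat; case: (phi x) (h x) => // ->.
Qed.

Lemma dens_le1 (R : realFieldType) (U V : finType) (phi : pred {ffun U -> V}) :
  dens R phi <= 1.
Proof.
rewrite /dens; have [->|n0] := posnP #|{ffun U -> V}|.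
  by rewrite invr0 mulr0.
rewrite ler_pdivrMr ?ltr0n // mul1r -natr_sum ler_nat -sum1_card.
by apply: leq_sum => x _; case: (phi x).
Qed.

(** Coordinates outside [D] are free, so that densities for different [D] live on the same space of
    maps and can be compared directly. *)
Definition multipartite (U V C : finType) (r : rel V) (c : U -> C) (D : {set U})
    (x : {ffun U -> V}) :=
  [forall u in D, forall w in D, (c u != c w) ==> r (x u) (x w)].

Lemma multipartiteP (U V C : finType) (r : rel V) (c : U -> C) (D : {set U})
    (x : {ffun U -> V}) :
  reflect (forall u w, u \in D -> w \in D -> c u != c w -> r (x u) (x w))
          (multipartite r c D x).
Proof.
apply: (iffP forall_inP) => h u.
  by move=> w uD wD cc; have /forall_inP /(_ w wD) /implyP := h u uD; apply.
by move=> uD; apply/forall_inP => w wD; apply/implyP; exact: h.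
Qed.

(* Cauchy-Schwarz, for the number of admissible images of [v] as a function of
   the images of the other vertices. *)
Lemma dens_twin (R : realFieldType) (U V C : finType) (r : rel V) (c : U -> C)
    (D : {set U}) (u v : U) :
  (0 < #|V|)%N -> symmetric r -> v \in D -> c u = c v ->
  dens R (multipartite r c D) ^+ 2 <= dens R (multipartite r c (u |: D)).
Proof.
move=> V0 rsym vD cuv; have [uD|uD] := boolP (u \in D).
  rewrite (finset.setUidPr _) ?finset.sub1set // expr2 ler_piMl ?dens_ge0 ?dens_le1 //.
pose F x : R := (multipartite r c D x)%:R.
pose F' x : R := (multipartite r c (u |: D) x)%:R.
set n : R := #|V|%:R; have n0 : 0 < n by rewrite ltr0n.
set N : R := #|{ffun U -> V}|%:R.
have N0 : 0 < N by rewrite ltr0n card_ffun_gt0.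
have vu : v != u by apply: contraNneq uD => <-.
(* If [a] and [b] are both admissible images of [v], then [v] can be sent to [a] and its twin [u] to
   [b]: the two have the same colour, so no edge between them is required. *)
have key x a b : F (upd x v a) * F (upd x v b) <= F' (upd (upd x v a) u b).
  rewrite /F /F' -natrM mulnb ler_nat.
  case: (boolP (_ && _)) => //= /andP[/multipartiteP ha /multipartiteP hb].
  suff -> : multipartite r c (u |: D) (upd (upd x v a) u b) by [].
  apply/multipartiteP => s t.
  have main w : w \in D -> c u != c w ->
      r b (upd (upd x v a) u b w).
    move=> wD cw; have := hb v w vD wD; rewrite -cuv => /(_ cw).
    rewrite !ffunE eqxx.
    have -> : w == v = false by apply: contraNF cw => /eqP ->; rewrite cuv.
    have -> // : w == u = false by apply: contraNF uD => /eqP <-.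
  have updu : upd (upd x v a) u b u = b by rewrite ffunE eqxx.
  have updD w : w != u -> upd (upd x v a) u b w = upd x v a w.
    by move=> wu; rewrite ffunE (negPf wu).
  rewrite !inE; have [->|su] := eqVneq s u; have [->|tu] := eqVneq t u => //=.
  - by rewrite eqxx.
  - by move=> _ tD ct; rewrite updu main.
  - by move=> sD _ cs; rewrite updu rsym main // eq_sym.
  - by move=> sD tD cst; rewrite !updD //; exact: ha.
have E1 : \sum_x (\sum_a F (upd x v a)) ^+ 2 <= n * (n * \sum_x F' x).
  rewrite -(sum_upd u) -/n -(sum_upd v (fun x => \sum_a F' (upd x u a))).
  apply: ler_sum => x _; rewrite expr2 big_distrlr /=.
  by apply: ler_sum => a _; apply: ler_sum => b _; exact: key.
have E2 := sqr_sum_le (fun x => \sum_a F (upd x v a)).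
rewrite sum_upd -/n -/N in E2.
rewrite /dens expr_div_n -/N ler_pdivrMr ?exprn_gt0 //.
rewrite [X in _ * X]expr2 mulrA divfK ?gt_eqF //.
have : n ^+ 2 * (\sum_x F x) ^+ 2 <= n ^+ 2 * (N * \sum_x F' x).
  rewrite -exprMn; apply: le_trans E2 _.
  by rewrite mulrCA ler_pM2l // expr2 -mulrA.
by rewrite ler_pM2l ?exprn_gt0 // [X in _ -> _ <= X]mulrC.
Qed.

(** Vertices are added one by one as twins of vertices of [D]; each addition squares the lower
    bound, whence the exponent [2 ^ size s]. *)
Lemma dens_blowup (R : realFieldType) (U V C : finType) (r : rel V) (c : U -> C)
    (D : {set U}) (s : seq U) :
  (0 < #|V|)%N -> symmetric r ->
  (forall u, u \in s -> exists2 v, v \in D & c u = c v) ->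
  dens R (multipartite r c D) ^+ (2 ^ size s) <=
  dens R (multipartite r c ([set u in s] :|: D)).
Proof.
move=> V0 rsym; elim: s => [|u s IH] hs.
  rewrite expr1 (_ : _ :|: D = D) //; apply/setP => x; by rewrite !inE.
have /IH {}IH v : v \in s -> exists2 w, w \in D & c v = c w.
  by move=> vs; apply: hs; rewrite inE vs orbT.
have [v vD cuv] := hs u (mem_head _ _).
have -> : [set w in u :: s] :|: D = u |: ([set w in s] :|: D).
  by apply/setP => w; rewrite !inE orbA.
apply: le_trans (dens_twin R V0 rsym (v := v) _ cuv); last by rewrite inE vD orbT.
rewrite /= expnS mulnC exprM lerXn2r ?nnegrE ?exprn_ge0 ?dens_ge0 //.
Qed.

(** * Supersaturation *)

Lemma eq_dens (R : realFieldType) (U V : finType) (phi psi : pred {ffun U -> V}) :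
  phi =1 psi -> dens R phi = dens R psi.
Proof.
by move=> h; rewrite /dens; under eq_bigr do rewrite h.
Qed.

Lemma dens_true (R : realFieldType) (U V : finType) :
  (0 < #|V|)%N -> dens R (fun _ : {ffun U -> V} => true) = 1.
Proof.
move=> V0; rewrite /dens sumr_const divff // pnatr_eq0 -lt0n.
exact: card_ffun_gt0.
Qed.

Lemma dens_exists (R : realFieldType) (U V S : finType)
    (phi : S -> pred {ffun U -> V}) :
  dens R (fun x => [exists s, phi s x]) <= \sum_s dens R (phi s).
Proof.
rewrite /dens -mulr_suml exchange_big /= ler_wpM2r ?invr_ge0 //.
apply: ler_sum => x _; case: existsP => [[s hs]|_]; last exact: sumr_ge0.
by rewrite (bigD1 s) //= hs lerDl sumr_ge0.
Qed.

Lemma dens_edges (R : realFieldType) (U V : finType) (g r : rel V) (q d : R)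
    (L L' : seq (U * U)) :
  0 <= q <= 1 -> (0 < #|V|)%N -> quasirandom r q d ->
  all (fun e => e.1 != e.2) L' -> pairwise (@apart U) L' ->
  allrel (@apart U) L' L ->
  `|dens R (fun x : {ffun U -> V} => sat g L x && sat r L' x)
    - q ^+ size L' * dens R (fun x : {ffun U -> V} => sat g L x)|
    <= (size L')%:R * d.
Proof.
move=> q01 V0 qr h1 h2 h3.
have N0 : 0 < #|{ffun U -> V}|%:R :> R by rewrite ltr0n card_ffun_gt0.
rewrite mulrA -mulrBl normrM [`|_^-1|]gtr0_norm ?invr_gt0 //.
by rewrite ler_pdivrMr //; exact: count_edges.
Qed.

Lemma dens_pair (R : realFieldType) (U V : finType) (r : rel V) (u v : U) :
  u != v -> (0 < #|V|)%N ->
  dens R (fun x : {ffun U -> V} => r (x u) (x v)) =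
  (\sum_a \sum_b (r a b)%:R) / #|V|%:R ^+ 2.
Proof.
move=> uv V0.
have N0 : #|{ffun U -> V}|%:R != 0 :> R by rewrite pnatr_eq0 -lt0n card_ffun_gt0.
have n0 : #|V|%:R != 0 :> R by rewrite pnatr_eq0 -lt0n.
apply/eqP; rewrite /dens eqr_div ?expf_neq0 //; apply/eqP.
rewrite mulrC expr2 -mulrA -(sum_upd v).
rewrite -(sum_upd u (fun x => \sum_b (r (upd x v b u) (upd x v b v))%:R)) mulr_natr.
rewrite -sumr_const; apply: eq_bigr => x _; apply: eq_bigr => a _.
by apply: eq_bigr => b _; rewrite !ffunE !eqxx (negPf uv).
Qed.

Lemma card_offdiag (m : nat) :
  #|[pred e : 'I_m * 'I_m | e.1 != e.2]| = (m * m.-1)%N.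
Proof.
rewrite -sum1_card (eq_bigl (fun e => true && (e.1 != e.2))) //.
rewrite -(pair_big_dep xpredT (fun i j : 'I_m => i != j) (fun _ _ => 1%N)) /=.
rewrite -[X in (X * _)%N]card_ord -sum_nat_const; apply: eq_bigr => i _.
rewrite sum1_card -[in RHS](card_ord m) -(cardC1 i); apply: eq_card => j.
by rewrite !inE eq_sym.
Qed.

(** Listing only increasing pairs makes the list pairwise [apart], as edge counting demands. *)
Definition ordered_pairs (m : nat) : seq ('I_m * 'I_m) :=
  [seq e : 'I_m * 'I_m <- enum {: 'I_m * 'I_m} | (e.1 < e.2)%N].

(* Here and below [k] is [r.+2], so that [1 - 1/(k-1)] is [r / r.+1]. *)
Lemma supersaturation (R : realFieldType) (U V : finType) (m r : nat)
    (f : 'I_m -> U) (g g' : rel V) (p d eta gam : R) :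
  injective f -> (0 < #|V|)%N -> (1 < m)%N -> 0 <= p <= 1 ->
  symmetric g -> symmetric g' -> irreflexive g' -> subrel g' g ->
  quasirandom g p d -> 0 <= d -> 0 < gam -> 0 <= eta ->
  r%:R / r.+1%:R + eta <= 1 ->
  gam + (2 * m ^ 2 + 1)%:R * d <= p ^+ (m ^ 2).+1 * (eta / 2) ->
  r%:R / r.+1%:R * m%:R <= (r%:R / r.+1%:R + eta / 2) * m.-1%:R ->
  (r%:R / r.+1%:R + eta) * p * #|V|%:R ^+ 2 <= \sum_a \sum_b (g' a b)%:R ->
  exists s : {ffun 'I_r.+2 -> 'I_m},
    gam / (2 * (m ^ r.+2)%:R) <=
    dens R (fun x : {ffun U -> V} =>
       [forall i, forall j, (i != j) ==> g' (x (f (s i))) (x (f (s j)))]).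
Proof.
move=> finj V0 m1 p01 gsym gsym' girr gg qr d0 gam0 eta0 tau1 hgam hm hD.
have /andP[p0 p1] := p01.
set tau := r%:R / r.+1%:R in tau1 hm hD *.
have tau0 : 0 <= tau by rewrite divr_ge0.
(* Half of [eta] absorbs the ratio of [m] to [m.-1] in Turan's bound; the other half pays for [gam]
   and the counting errors. *)
set kap := tau + eta / 2 in hm.
have kap1 : kap <= 1 by rewrite /kap; lra.
have kap0 : 0 <= kap by rewrite /kap; lra.
pose f2 (e : 'I_m * 'I_m) := (f e.1, f e.2).
have f2inj : injective f2 by move=> [a b] [c e] [] /finj -> /finj ->.
pose cl (x : {ffun U -> V}) := sat g (map f2 (ordered_pairs m)) x.
pose P x := [exists s : {ffun 'I_r.+2 -> 'I_m},
   [forall i, forall j, (i != j) ==> g' (x (f (s i))) (x (f (s j)))]].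
have satE L (x : {ffun U -> V}) (h : rel V) :
    sat h (map f2 L) x = all (fun e => h (x (f e.1)) (x (f e.2))) L.
  by rewrite /sat all_map.
have clE x i j : cl x -> i != j -> g (x (f i)) (x (f j)).
  rewrite /cl satE => /allP h ij; have [lt|gt|eq] := ltngtP i j.
  - by apply: (h (i, j)); rewrite mem_filter /= lt mem_enum.
  - by rewrite gsym; apply: (h (j, i)); rewrite mem_filter /= gt mem_enum.
  - by case/eqP: ij; exact: val_inj.
(* Let [M] be the clique pairs other than [ij]. Cliques of [g] have density about
   [p ^+ (size M).+1], and those with [ij] in [g'] about [p ^+ size M] times the density of [g'],
   which is at least [(tau + eta) * p]. *)
have pairs i j : i != j ->
  gam + kap * dens R cl <=
  dens R (fun x => cl x && g' (x (f i)) (x (f j))).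
  move=> ij.
  pose M := [seq e <- ordered_pairs m | (e != (i, j)) && (e != (j, i))].
  have Msz : (size M <= m ^ 2)%N.
    rewrite size_filter (leq_trans (count_size _ _)) //.
    rewrite size_filter (leq_trans (count_size _ _)) //.
    by rewrite -cardE card_prod card_ord.
  have M1 : all (fun e => e.1 != e.2) (map f2 M).
    rewrite all_map; apply/allP => e /=; rewrite !mem_filter (inj_eq finj).
    by case/and3P => _ lt _; apply: contraTneq lt => ->; rewrite ltnn.
  have apf2 e e' : apart (f2 e) (f2 e') = apart e e'.
    have -> : apart (f2 e) (f2 e') = (f2 e != f2 e') && (f2 e != f2 (e'.2, e'.1)) by [].
    by rewrite !(inj_eq f2inj).
  have M2 : pairwise (@apart U) (map f2 M).
    rewrite pairwise_map.
    have : uniq M by do 2 apply: filter_uniq; exact: enum_uniq.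
    rewrite uniq_pairwise => MP.
    apply: (sub_in_pairwise (P := mem M) _ _ MP); last exact/allP.
    move=> e e'; rewrite !mem_filter => /and3P[_ lt _] /and3P[_ lt' _] /= ne.
    rewrite apf2 /apart ne; apply: contraTneq lt => -> /=.
    by rewrite -leqNgt ltnW.
  have M3 : all (apart (f2 (i, j))) (map f2 M).
    rewrite all_map; apply/allP => e; rewrite !mem_filter => /and3P[/andP[n1 n2] _ _].
    rewrite /= apf2 /apart eq_sym n1 /=.
    by apply: contraNneq n2; case: e {n1} => a b /= [-> ->].
  have ijU : f i != f j by rewrite (inj_eq finj).
  have clM x : cl x = g (x (f i)) (x (f j)) && sat g (map f2 M) x.
    apply/idP/andP => [clx|[gij]].
      split; first exact: clE.
      move: clx; rewrite /cl !satE => /allP h; apply/allP => e.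
      by rewrite mem_filter => /andP[_ /h].
    rewrite /cl !satE => /allP h; apply/allP => e eP.
    have [->//|n1] := eqVneq e (i, j); have [->|n2] := eqVneq e (j, i).
      by rewrite gsym.
    by apply: h; rewrite mem_filter n1 n2.
  (* The pair [ij] is held in [g'], where membership in [g] is automatic; the other pairs are
     counted by the pseudorandomness of [g]. *)
  have Y : `|dens R (fun x => cl x && g' (x (f i)) (x (f j)))
      - p ^+ size M * dens R (fun x : {ffun U -> V} => g' (x (f i)) (x (f j)))|
      <= (size M)%:R * d.
    have := dens_edges g' p01 V0 qr M1 M2 (L := [:: f2 (i, j)]) _.
    rewrite size_map => /(_ _) H; apply: le_trans (H _).
      rewrite le_eqVlt; apply/orP; left; apply/eqP; congr (`|_ - _ * _|).
        apply: eq_dens => x; rewrite clM /= andbT andbC.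
        by case: (boolP (g' _ _)) => //= /gg ->.
      by apply: eq_dens => x; rewrite /= andbT.
    rewrite allrel_consr /= allrel0r andbT.
    apply: sub_all M3 => e; rewrite /apart eq_sym => /andP[-> ].
    by apply: contraNN => /eqP ->; case: (f2 _).
  have C : `|dens R cl - p ^+ (size M).+1| <= (size M).+1%:R * d.
    have := dens_edges g' p01 V0 qr (L' := f2 (i, j) :: map f2 M) (L := [::]).
    rewrite /= M1 M2 M3 ijU allrel0r size_map dens_true // mulr1 => /(_ isT isT isT).
    apply: le_trans; rewrite le_eqVlt; apply/orP; left; apply/eqP.
    by congr (`|_ - _|); apply: eq_dens => x; rewrite clM.
  move: Y C; rewrite dens_pair //.
  set l := size M in Msz *; set Y := dens R _; set C := dens R _; set D := _ / _.
  have D1 : (tau + eta) * p <= D.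
    by rewrite ler_pdivlMr // exprn_gt0 // ltr0n.
  rewrite !ler_norml => /andP[Y1 _] /andP[_ C1].
  have pl : p ^+ (m ^ 2).+1 <= p ^+ l.+1.
    by apply: ler_wiXn2l.
  have pl0 : 0 <= p ^+ l by exact: exprn_ge0.
  have h1 : p ^+ l * ((tau + eta) * p) <= p ^+ l * D by rewrite ler_wpM2l.
  have h2 : kap * C <= kap * (p ^+ l.+1 + l.+1%:R * d).
    by rewrite ler_wpM2l //; lra.
  have h3 : kap * (l.+1%:R * d) <= l.+1%:R * d.
    by rewrite ler_piMl // mulr_ge0.
  have h4 : (2 * l + 1)%:R * d <= (2 * m ^ 2 + 1)%:R * d.
    by rewrite ler_wpM2r // ler_nat leq_add2r leq_mul2l Msz orbT.
  have h5 : p ^+ (m ^ 2).+1 * (eta / 2) <= p ^+ l.+1 * (eta / 2).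
    by rewrite ler_wpM2r // divr_ge0.
  move: h1 h2 h3 h4 h5; rewrite exprS /kap -[l.+1]addn1 !natrD natrM; nra.
pose K : R := (m * m.-1)%:R.
have Ktau : tau * m%:R ^+ 2 <= kap * K.
  by rewrite /K natrM (mulrC m%:R) expr2 !mulrA ler_wpM2r.
(* Sum over the [K] ordered pairs. By Turan, a clique of [g] failing [P] contributes at most
   [tau * m%:R ^+ 2 <= kap * K], so the excess [K * gam] must come from maps satisfying [P], each
   worth at most [m%:R ^+ 2]. *)
have main : K * gam <= m%:R ^+ 2 * dens R P.
  have : \sum_(e : 'I_m * 'I_m | e.1 != e.2) (gam + kap * dens R cl) <=
     \sum_(e : 'I_m * 'I_m | e.1 != e.2)
        dens R (fun x => cl x && g' (x (f e.1)) (x (f e.2))).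
    by apply: ler_sum => -[i j] /=; exact: pairs.
  rewrite sumr_const card_offdiag -[X in X <= _]mulr_natl -/K mulrDr.
  rewrite -lerBrDr => /le_trans; apply.
  rewrite -mulr_suml mulrCA mulrA /dens (mulrA (_ * _)) -mulrBl mulrA.
  rewrite ler_wpM2r ?invr_ge0 // !mulr_sumr exchange_big /= -sumrB.
  apply: ler_sum => x _.
  case clx : (cl x) => /=; last first.
    by rewrite mulr0 subr0 big1 ?mulr_ge0 // exprn_ge0.
  set e' := \sum_(_ | _) _; rewrite mulr1.
  have e'E : e' = (\sum_(i in [set: 'I_m]) \sum_(j in [set: 'I_m])
       g' (x (f i)) (x (f j)))%N%:R.
    rewrite pair_big_dep /= natr_sum /e' big_mkcond [RHS]big_mkcond /=.
    apply: eq_bigr => -[i j] _ /=; rewrite !inE /=.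
    by case: eqVneq => // ->; rewrite girr.
  case Px : (P x); last first.
    rewrite mulr0 subr_le0 leNgt; apply/negP => /(le_lt_trans Ktau) h.
    suff: P x by rewrite Px.
    have [|||s [ss _ ps]] := @turan _ (fun i j => g' (x (f i)) (x (f j))) r [set: 'I_m].
    - by move=> i j; exact: gsym'.
    - by move=> i; exact: girr.
    - move: h; rewrite e'E /tau mulrAC ltr_pdivrMr ?ltr0n // -natrX -!natrM ltr_nat.
      by rewrite cardsT card_ord mulnC [X in (_ < X)%N]mulnC.
    apply/existsP; exists [ffun i => tnth (Tuple (introT eqP ss)) i].
    apply/forallP => i; apply/forallP => j; apply/implyP => ij; rewrite !ffunE.
    wlog ltij : i j ij / (i < j)%N.
      move=> H; have [lt|gt|eq] := ltngtP i j; first exact: H.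
        by rewrite gsym'; apply: H => //; rewrite eq_sym.
      by case/eqP: ij; exact: val_inj.
    have x0 : 'I_m := tnth (Tuple (introT eqP ss)) i.
    rewrite !(tnth_nth x0) /=.
    have /(pairwiseP x0) := ps; apply => //; by rewrite inE ss ltn_ord.
  rewrite mulr1; apply: le_trans (_ : e' <= _).
    by rewrite gerBl mulr_ge0.
  rewrite e'E -natrX ler_nat.
  apply: (@leq_trans (\sum_(i in [set: 'I_m]) \sum_(j in [set: 'I_m]) 1)%N).
    by apply: leq_sum => i _; apply: leq_sum => j _; case: (g' _ _).
  by rewrite !sum_nat_const cardsT card_ord muln1.
have half : gam / 2 <= dens R P.
  have Km : m%:R ^+ 2 <= 2 * K.
    rewrite /K -natrX -natrM ler_nat -mulnn mulnCA leq_mul2l; clear -m1; lia.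
  have : m%:R ^+ 2 * (gam / 2) <= m%:R ^+ 2 * dens R P.
    apply: le_trans main.
    have := ler_wpM2r (ltW gam0) Km; lra.
  by rewrite ler_pM2l // exprn_gt0 // ltr0n ltnW.
(* Pigeonhole over the [m ^ r.+2] possible positions [s] of the clique of [g']. *)
apply/existsP; apply: contraLR half; rewrite negb_exists => /forallP h.
  rewrite -ltNge; apply: le_lt_trans (dens_exists _ _) _.
  pose S : finType := {ffun 'I_r.+2 -> 'I_m}.
  have S0 : (0 < #|S|)%N by rewrite card_ffun expn_gt0 card_ord ltnW.
  have -> : gam / 2 = \sum_(s : S) gam / (2 * (m ^ r.+2)%:R).
    rewrite sumr_const card_ffun !card_ord invfM mulrA -[RHS]mulr_natr divfK //.
    by rewrite pnatr_eq0 -lt0n expn_gt0 ltnW.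
  have [s0 _] : exists s0 : S, true by case/card_gt0P: S0 => s0 _; exists s0.
  rewrite (bigD1 s0) //= [X in _ < X](bigD1 s0) //=.
  apply: ltr_leD; first by rewrite ltNge h.
  by apply: ler_sum => s _; rewrite leNgt; apply/negP => /ltW; exact/negP.
Qed.

(** * Embedding an induced subgraph *)

Lemma dens_gt0 (R : realFieldType) (U V : finType) (phi : pred {ffun U -> V}) :
  0 < dens R phi -> exists x, phi x.
Proof.
move=> h; apply/existsP; apply: contraLR h; rewrite negb_exists => /forallP h.
rewrite /dens big1 ?mul0r ?ltxx // => x _; by rewrite (negPf (h x)).
Qed.

(** The diagonal removed from the complement has at most [#|V|] pairs, hence the extra error
    [#|V|%:R^-1]. Removing it forces non-adjacent vertices to receive distinct images. *)
Lemma quasirandom_compl (R : realFieldType) (V : finType) (g : rel V) (p d : R) :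
  (0 < #|V|)%N -> irreflexive g -> quasirandom g p d ->
  quasirandom (fun a b => (a != b) && ~~ g a b) (1 - p) (d + #|V|%:R^-1).
Proof.
move=> V0 girr qr A B; set n : R := #|V|%:R.
have n0 : n != 0 by rewrite pnatr_eq0 -lt0n.
set E : R := \sum_(a in A) \sum_(b in B) (a == b)%:R.
have E0 : 0 <= E by apply: sumr_ge0 => a _; exact: sumr_ge0.
have En : E <= n.
  apply: (@le_trans _ _ (\sum_(a in A) 1)).
    apply: ler_sum => a _; rewrite -natr_sum lern1 big_mkcond.
    rewrite (bigD1 a) //= big1 ?addn0 => [|b]; first by case: ifP => //; rewrite eqxx.
    by rewrite eq_sym => /negPf ->; case: ifP.
  by rewrite sumr_const ler_nat max_card.
have -> : \sum_(a in A) \sum_(b in B) ((a != b) && ~~ g a b)%:R =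
   #|A|%:R * #|B|%:R - \sum_(a in A) \sum_(b in B) (g a b)%:R - E :> R.
  have -> : #|A|%:R * #|B|%:R = \sum_(a in A) \sum_(b in B) 1 :> R.
    under eq_bigr do rewrite sumr_const.
    by rewrite sumr_const -natrM -mulrnA mulnC.
  rewrite -!sumrB; apply: eq_bigr => a _; rewrite -!sumrB; apply: eq_bigr => b _.
  by case: eqVneq => [->|_]; rewrite ?girr; [|case: (g a b)] => /=; ring.
have := qr A B; rewrite -/n; set S := \sum_(a in A) _.
have -> : (d + n^-1) * n ^+ 2 = d * n ^+ 2 + n.
  by rewrite mulrDl expr2 mulKf // -expr2.
by rewrite !ler_norml => /andP[h1 h2]; apply/andP; split; lra.
Qed.

(** The last clause of the conclusion serves subgraphs on a vertex subset: a vertex with a neighbour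
    in [g'] must lie in that subset. *)
Lemma induced_embedding (R : archiRealFieldType) (T : finType) (r : nat) (h : rel T)
    (c : T -> 'I_r.+2) (p eta : R) :
  0 < p < 1 -> 0 < eta -> symmetric h -> (forall a b, h a b -> c a != c b) ->
  exists d : R, 0 < d /\ exists n0 : nat,
  forall (V : finType) (g g' : rel V), (n0 <= #|V|)%N ->
    symmetric g -> irreflexive g -> symmetric g' -> subrel g' g ->
    quasirandom g p d ->
    (r%:R / r.+1%:R + eta) * p * #|V|%:R ^+ 2 <= \sum_a \sum_b (g' a b)%:R ->
    exists x : T -> V, [/\ injective x, forall a b, h a b = g' (x a) (x b)
      & forall a, exists v, g' (x a) v].
Proof.
(* Shrinking [eta] weakens the density hypothesis, so [tau + eta <= 1] may be assumed, as
   supersaturation requires. *)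
move=> /andP[p0 p1]; wlog eta1 : eta / eta <= r.+1%:R^-1.
  move=> H eta0 hsym hc; pose eta' := Num.min eta r.+1%:R^-1.
  have [||||d [d0 [n0 hd]]] := H eta' => //.
  - by rewrite ge_min lexx orbT.
  - by rewrite lt_min eta0 invr_gt0 ltr0n.
  exists d; split=> //; exists n0 => V g g' h1 h2 h3 h4 h5 h6 h7.
  apply: (hd V g g') => //; apply: le_trans h7.
  rewrite ler_wpM2r ?sqr_ge0 // ler_wpM2r ?(ltW p0) // lerD2l ge_min lexx //.
move=> eta0 hsym hc.
have hirr a : h a a = false by apply/negP => /hc; rewrite eqxx.
have p01 : 0 <= p <= 1 by rewrite !ltW.
(* Large enough that [eta / 2 * m.-1%:R >= 1 >= tau]. *)
pose m := (Num.bound (2 / eta)).+2.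
have tauE : r%:R / r.+1%:R = 1 - r.+1%:R^-1 :> R.
  apply: (canLR (mulfK _)); first by rewrite pnatr_eq0.
  by rewrite mulrBl mul1r mulVf ?pnatr_eq0 // -addn1 natrD addrK.
set tau : R := r%:R / r.+1%:R in tauE *.
have tau1 : tau + eta <= 1 by rewrite tauE -addrA gerDl addrC subr_le0.
have tau0 : 0 <= tau by rewrite divr_ge0.
have hm : tau * m%:R <= (tau + eta / 2) * m.-1%:R.
  have b := archi_boundP (divr_ge0 (ler0n R 2) (ltW eta0)).
  have {}b : 2 / eta <= m.-1%:R.
    by apply: ltW; apply: lt_le_trans b _; rewrite ler_nat leqnSn.
  have {}b : 1 <= eta / 2 * m.-1%:R.
    have := ler_wpM2l (ltW (divr_gt0 eta0 (ltr0n R 2))) b.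
    by rewrite mulrA divfK ?pnatr_eq0 // divff // gt_eqF.
  have -> : m%:R = m.-1%:R + 1 :> R by rewrite natr1.
  move: b; set M := m.-1%:R; lra.
(* A quarter of what supersaturation allows; the counting error is kept below another quarter by the
   choice of [d]. *)
pose gam : R := p ^+ (m ^ 2).+1 * (eta / 8).
have gam0 : 0 < gam by rewrite mulr_gt0 ?exprn_gt0 ?divr_gt0.
pose gam1 : R := gam / (2 * (m ^ r.+2)%:R).
have gam10 : 0 < gam1 by rewrite divr_gt0 // mulr_gt0 // ltr0n expn_gt0.
pose beta := gam1 ^+ (2 ^ #|T|).
have beta0 : 0 < beta by rewrite exprn_gt0.
pose t2 := (#|T| ^ 2)%N.
pose q := 1 - p; have q0 : 0 < q by rewrite subr_gt0.
have q01 : 0 <= q <= 1 by rewrite ltW //= /q; lra.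
(* At most [t2] non-edges cost at most [dd + dd] each, in total less than the main term
   [q ^+ t2 * beta]. *)
pose dd := q ^+ t2 * beta / (4 * t2.+1%:R).
have dd0 : 0 < dd by rewrite divr_gt0 ?mulr_gt0 ?exprn_gt0.
pose d := Num.min dd (gam / (2 * m ^ 2 + 1)%:R).
have d0 : 0 < d by rewrite lt_min dd0 divr_gt0 // ltr0n addn1.
exists d; split=> //; exists (Num.bound dd^-1).+1 => V g g' Vn gsym girr gsym' gg qr big.
have V0 : (0 < #|V|)%N by apply: leq_trans Vn.
have girr' : irreflexive g' by move=> a; apply: contraFF (girr a) => /gg.
(* The vertices of [h] are placed together with [m] auxiliary vertices; [r.+2] of the latter will
   span a clique of [g'] and serve as anchors, one for each colour. *)
pose U : finType := (T + 'I_m)%type.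
have inrI : injective (inr : 'I_m -> U) by move=> i j [].
have inlI : injective (inl : T -> U) by move=> i j [].
have [s hs] : exists s : {ffun 'I_r.+2 -> 'I_m}, gam1 <=
    dens R (fun x : {ffun U -> V} =>
       [forall i, forall j, (i != j) ==> g' (x (inr (s i))) (x (inr (s j)))]).
  apply: (supersaturation inrI V0 _ p01 gsym gsym' girr' gg qr (ltW d0) gam0 (ltW eta0)) => //.
  have : (2 * m ^ 2 + 1)%:R * d <= gam.
    by rewrite mulrC -ler_pdivlMr ?ltr0n ?addn1 // -addn1 ge_min lexx orbT.
  move/(lerD (lexx gam))/le_trans; apply.
  have := exprn_ge0 (m ^ 2).+1 (ltW p0); rewrite /gam; nra.
(* A repeated position would demand a loop of [g'], making the density zero. *)
have sinj : injective s.
  move=> i j sij; apply/eqP; apply: contraTT gam10 => ij.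
  rewrite -leNgt (le_trans hs) // le_eqVlt; apply/orP; left; apply/eqP.
  rewrite /dens big1 ?mul0r // => x _; case: forallP => // /(_ i) /forallP /(_ j).
  by rewrite ij sij girr'.
(* The anchor [inr (s j)] gets colour [j]. The default colour goes to auxiliary vertices that are
   not anchors, and these lie outside [D]. *)
pose cU (u : U) := match u with inl a => c a
   | inr i => odflt ord0 [pick j | s j == i] end.
have cUs j : cU (inr (s j)) = j.
  rewrite /=; case: pickP => [j' /eqP /sinj -> //|/(_ j)]; by rewrite eqxx.
pose D0 : {set U} := [set inr (s j) | j in 'I_r.+2].
pose D := [set u in map inl (enum T)] :|: D0.
have inD a : inl a \in D by rewrite !inE mem_map // mem_enum.
have inDs j : inr (s j) \in D by rewrite inE imset_f ?orbT.
have hD : beta <= dens R (multipartite g' cU D : pred {ffun U -> V}).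
  have := @dens_blowup R U V _ g' cU D0 (map inl (enum T)) V0 gsym'.
  rewrite size_map -cardE => H; apply: le_trans (H _); last first.
    move=> u /mapP[a _ ->]; exists (inr (s (c a))); first exact: imset_f.
    by rewrite cUs.
  rewrite lerXn2r ?nnegrE ?dens_ge0 ?(ltW gam10) //.
  apply: le_trans hs _; apply: le_dens => x /forallP hx.
  apply/multipartiteP => _ _ /imsetP[i _ ->] /imsetP[j _ ->]; rewrite !cUs => ij.
  by have /forallP /(_ j) /implyP := hx i; exact.
(* Besides the edges of [h], the edges to anchors of other colours are kept: they give every image a
   neighbour in [g']. *)
pose L : seq (U * U) := [seq (inl e.1, inl e.2) | e : T * T <- enum {: T * T} & h e.1 e.2] ++
  [seq (inl e.1, inr (s e.2)) | e : T * 'I_r.+2 <- enum {: T * 'I_r.+2} & c e.1 != e.2].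
(* The non-edges of [h], each listed once. They are apart from all pairs of [L], so each costs a
   factor of about [1 - p]. *)
pose L2 : seq (U * U) := [seq (inl e.1, inl e.2) |
  e : T * T <- enum {: T * T} & ~~ h e.1 e.2 && (enum_rank e.1 < enum_rank e.2)%N].
have hL : beta <= dens R (fun x : {ffun U -> V} => sat g' L x).
  apply: le_trans hD _; apply: le_dens => x /multipartiteP hx.
  rewrite /sat all_cat !all_map; apply/andP; split; apply/allP => -[a b];
    rewrite mem_filter => /andP[] /= ne _; apply: hx => //.
    exact: hc.
  by rewrite [cU (inr _)]cUs.
have L2sz : (size L2 <= t2)%N.
  rewrite size_map size_filter (leq_trans (count_size _ _)) //.
  by rewrite -cardE card_prod.
have qr' := quasirandom_compl V0 girr qr.
have L21 : all (fun e => e.1 != e.2) L2.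
  rewrite all_map; apply/allP => e; rewrite mem_filter => /andP[/andP[_ lt] _] /=.
  by rewrite (inj_eq inlI); apply: contraTneq lt => ->; rewrite ltnn.
have L22 : pairwise (@apart U) L2.
  rewrite pairwise_map; set M := [seq _ <- _ | _].
  have : uniq M by apply: filter_uniq; exact: enum_uniq.
  rewrite uniq_pairwise => MP.
  apply: (sub_in_pairwise (P := mem M) _ _ MP); last exact/allP.
  move=> [a b] [a' b']; rewrite !mem_filter /=.
  move=> /andP[/andP[_ lt] _] /andP[/andP[_ lt'] _] /=.
  rewrite /apart !xpair_eqE /= !(inj_eq inlI) => -> /=.
  by apply: contraTN lt => /andP[/eqP -> /eqP ->]; rewrite -leqNgt ltnW.
have L23 : allrel (@apart U) L2 L.
  apply/allrelP => _ u /mapP[[a b] + ->]; rewrite mem_filter => /andP[/= /andP[nh _] _].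
  rewrite mem_cat => /orP[] /mapP[[a' b']]; rewrite mem_filter /= => /andP[hh _] ->.
    rewrite /apart !xpair_eqE /= !(inj_eq inlI).
    apply/andP; split; apply: contraNN nh => /andP[/eqP -> /eqP ->] //.
    by rewrite hsym.
  by rewrite /apart !xpair_eqE /= andbF.
have := dens_edges g' q01 V0 qr' L21 L22 L23.
set X := dens R _; set Y := dens R _ in hL *; rewrite ler_norml => /andP[hX _].
have X0 : 0 < X.
  have hn : #|V|%:R^-1 <= dd.
    rewrite invf_ple ?posrE ?ltr0n //; apply: ltW.
    apply: lt_le_trans (archi_boundP _) _; first by rewrite invr_ge0 ltW.
    by rewrite ler_nat ltnW.
  have e1 : (size L2)%:R * (d + #|V|%:R^-1) <= t2%:R * (dd + dd).
    apply: ler_pM => //; first by rewrite addr_ge0 ?invr_ge0 // ltW.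
      by rewrite ler_nat.
    by rewrite lerD // ge_min lexx.
  have e2 : q ^+ t2 * beta <= q ^+ size L2 * Y.
    apply: ler_pM => //; rewrite ?exprn_ge0 ?(ltW q0) ?(ltW beta0) //.
    exact: ltW.
    by apply: ler_wiXn2l => //; [exact: ltW | case/andP: q01].
  have e3 : dd * (4 * t2.+1%:R) = q ^+ t2 * beta.
    by rewrite divfK // mulf_neq0 // pnatr_eq0.
  have e4 : 0 <= t2%:R * dd by rewrite mulr_ge0 // ltW.
  have arith (e t a b b' z : R) : 0 < e -> a <= t * (e + e) -> b <= b' ->
      e * (4 * (t + 1)) = b -> 0 <= t * e -> - a <= z - b' -> 0 < z.
    by clear; lra.
  by apply: (arith _ _ _ _ _ _ dd0 e1 e2 _ e4 hX); rewrite natr1.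
have [x /andP[/allP xL /allP xL2]] := dens_gt0 X0.
have x1 a b : h a b -> g' (x (inl a)) (x (inl b)).
  move=> hab; apply: (xL (inl a, inl b)); rewrite mem_cat; apply/orP; left.
  by apply/mapP; exists (a, b) => //; rewrite mem_filter hab mem_enum.
have x2 a b : a != b -> ~~ h a b ->
    (x (inl a) != x (inl b)) && ~~ g (x (inl a)) (x (inl b)).
  have main a' b' : (enum_rank a' < enum_rank b')%N -> ~~ h a' b' ->
      (x (inl a') != x (inl b')) && ~~ g (x (inl a')) (x (inl b')).
    move=> lt nh; apply: (xL2 (inl a', inl b')).
    by apply/mapP; exists (a', b') => //; rewrite mem_filter nh lt mem_enum.
  move=> ab nh; have [lt|gt|eq] := ltngtP (enum_rank a) (enum_rank b).
  - exact: main.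
  - by rewrite hsym in nh; rewrite (eq_sym (x _)) (gsym (x _)) main.
  - by case/eqP: ab; apply: enum_rank_inj; exact: val_inj.
exists (fun a => x (inl a)); split.
- move=> a b xab; apply/eqP; apply: contraT => ab; case: (boolP (h a b)).
    by move/x1; rewrite xab girr'.
  by move/(x2 a b ab)/andP => [/eqP].
- move=> a b; apply/idP/idP; first exact: x1.
  have [->|ab] := eqVneq a b; first by rewrite girr'.
  by move=> gab; apply: contraT => /(x2 a b ab)/andP[_]; rewrite (gg _ _ gab).
- move=> a; have [j cj] : exists j, c a != j.
    have [->|] := eqVneq (c a) ord0; last by exists ord0.
    by exists ord_max.
  exists (x (inr (s j))); apply: (xL (inl a, inr (s j))).
  rewrite mem_cat; apply/orP; right.
  by apply/mapP; exists (a, j) => //; rewrite mem_filter cj mem_enum.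
Qed.

(** * Pseudorandomness of the binomial random graph *)

(** Expanding the square gives the count of 4-cycles [a b a' b'] weighted by [F], the fourth power
    of the unnormalised box norm. *)
Definition codegree_energy (R : realFieldType) (V : finType) (F : V -> V -> R) : R :=
  \sum_a \sum_a' (\sum_b F a b * F a' b) ^+ 2.

(** Cauchy-Schwarz twice: over [b], discarding the indicator of [B], then over the pairs [(a, a')],
    discarding that of [A]. *)
Lemma cut_energy (R : realFieldType) (V : finType) (F : V -> V -> R) (A B : {set V}) :
  (\sum_(a in A) \sum_(b in B) F a b) ^+ 4 <= #|V|%:R ^+ 4 * codegree_energy F.
Proof.
set n : R := #|V|%:R; have n0 : 0 <= n by [].
rewrite exchange_big /=; set X := \sum_(b in B) _.
pose al a : R := (a \in A)%:R.
have al1 a a' : 0 <= al a * al a' <= 1.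
  rewrite /al; case: (_ \in _); case: (_ \in _);
    by rewrite /= ?mulr0 ?mul0r ?mulr1 ?lexx ?ler01.
pose Z := \sum_a \sum_a' al a * al a' * (\sum_b F a b * F a' b).
have XE : X = \sum_b (b \in B)%:R * \sum_a al a * F a b.
  rewrite /X big_mkcond; apply: eq_bigr => b _.
  case: (b \in B); rewrite ?mul0r // mul1r big_mkcond; apply: eq_bigr => a _.
  by rewrite /al; case: (a \in A); rewrite ?mul0r ?mul1r.
have XZ : X ^+ 2 <= n * Z.
  rewrite XE; apply: le_trans (sqr_sum_le _) _; rewrite ler_wpM2l //.
  have -> : Z = \sum_b (\sum_a al a * F a b) ^+ 2.
    under [RHS]eq_bigr do rewrite expr2 big_distrlr /=.
    rewrite [RHS]exchange_big /=; apply: eq_bigr => a _.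
    rewrite exchange_big /=; apply: eq_bigr => a' _.
    by rewrite mulr_sumr; apply: eq_bigr => b _; ring.
  apply: ler_sum => b _; rewrite exprMn.
  by rewrite ler_piMl ?sqr_ge0 //; case: (b \in B); rewrite /= ?expr1n // expr0n ler01.
have ZS : Z ^+ 2 <= n ^+ 2 * codegree_energy F.
  rewrite /Z /codegree_energy !pair_bigA /=; apply: le_trans (sqr_sum_le _) _.
  rewrite card_prod natrM -expr2 ler_wpM2l ?sqr_ge0 //.
  apply: ler_sum => -[a a'] _ /=; rewrite exprMn ler_piMl ?sqr_ge0 //.
  by have /andP[h0 h1] := al1 a a'; rewrite expr_le1.
have -> : X ^+ 4 = (X ^+ 2) ^+ 2 by rewrite -exprM.
apply: (@le_trans _ _ ((n * Z) ^+ 2)).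
  by rewrite lerXn2r ?nnegrE ?sqr_ge0 // (le_trans (sqr_ge0 X)).
have -> : n ^+ 4 * codegree_energy F = n ^+ 2 * (n ^+ 2 * codegree_energy F).
  by rewrite mulrA -exprD.
by rewrite exprMn ler_wpM2l ?sqr_ge0.
Qed.

Lemma energy_quasirandom (R : realFieldType) (V : finType) (r : rel V) (p d : R) :
  0 <= d ->
  codegree_energy (fun a b => (r a b)%:R - p) <= d ^+ 4 * #|V|%:R ^+ 4 ->
  quasirandom r p d.
Proof.
move=> d0 hS A B.
have -> : \sum_(a in A) \sum_(b in B) (r a b)%:R - p * (#|A|%:R * #|B|%:R) =
    \sum_(a in A) \sum_(b in B) ((r a b)%:R - p).
  under [RHS]eq_bigr do rewrite sumrB sumr_const.
  by rewrite sumrB sumr_const -natrM mulr_natr mulnC mulrnA.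
have := cut_energy (fun a b => (r a b)%:R - p) A B.
set X := \sum_(a in A) _ => hX; rewrite -(@ler_pXn2r _ 4) ?nnegrE ?mulr_ge0 //.
rewrite -normrX ger0_norm ?exprn_even_ge0 //; apply: le_trans hX _.
rewrite exprMn; apply: le_trans (ler_wpM2l _ hS) _; first by rewrite exprn_ge0.
by rewrite mulrCA -expr2 -!exprM.
Qed.

Section Expectation.
Variables (R : realType) (n : nat) (p : R).
Hypothesis p01 : 0 < p < 1.

Lemma gnp_ge0 (G : sgraph 'I_n) : 0 <= gnp p G.
Proof.
case/andP: p01 => p0 p1.
by apply: prodr_ge0 => e _; case: ifP => _; [exact: ltW | rewrite subr_ge0 ltW].
Qed.

(** Expand a product of factors [F e + F' e = 1] over all vertex sets [e]. Since [F] vanishes unless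
    [e] is a pair, only the terms indexed by graphs survive. *)
Lemma gnp_sum1 : \sum_(G : sgraph 'I_n) gnp p G = 1.
Proof.
pose F (e : {set 'I_n}) : R := if #|e| == 2%N then p else 0.
pose F' (e : {set 'I_n}) : R := if #|e| == 2%N then 1 - p else 1.
have <- : \prod_e (F e + F' e) = 1.
  by apply: big1 => e _; rewrite /F /F'; case: ifP; rewrite ?add0r // addrC subrK.
rewrite bigA_distr /=.
have [G0 _] : exists G0 : sgraph 'I_n, true.
  have P : [forall e in finset.set0 : {set {set 'I_n}}, #|e| == 2%N].
    by apply/forall_inP => e; rewrite inE.
  by exists (SGraph P).
rewrite (bigID (fun J : {set {set 'I_n}} => [forall e in J, #|e| == 2%N])) /=.
rewrite [X in _ + X]big1 ?addr0 => [|J]; last first.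
  rewrite negb_forall => /existsP[e]; rewrite negb_imply => /andP[eJ e2].
  by rewrite (bigD1 e) //= eJ /F (negPf e2) mul0r.
rewrite (reindex_onto (@edges 'I_n) (insubd G0)) => [|J hJ]; last exact: insubdK.
apply: eq_big => [G|G _].
  by rewrite (valP G) /= valKd eqxx.
rewrite /gnp big_mkcond; apply: eq_bigr => e _; rewrite /F /F'.
case: ifP => // e2; case: ifP => // eG.
by rewrite (card_edge eG) in e2.
Qed.

Lemma toggle_subproof (G : sgraph 'I_n) (a b : 'I_n) : a != b ->
  [forall e in (if [set a; b]%SET \in edges G then (edges G :\ [set a; b])%SET
    else ([set a; b] |: edges G)%SET), #|e| == 2%N].
Proof.
move=> ab; apply/forall_inP => e; case: ifP => _; rewrite !inE.
  by case/andP => _ /card_edge ->.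
by case/orP => [/eqP ->|/card_edge -> //]; rewrite cards2 ab.
Qed.

Definition toggle (a b : 'I_n) (ab : a != b) (G : sgraph 'I_n) : sgraph 'I_n :=
  SGraph (toggle_subproof G ab).
#[local] Arguments toggle : simpl never.

Lemma toggle_edges (a b : 'I_n) (ab : a != b) (G : sgraph 'I_n) (e : {set 'I_n}) :
  (e \in edges (toggle ab G)) = (e \in edges G) (+) (e == [set a; b]%SET).
Proof.
rewrite [edges _]/=; case: ifP => h; rewrite !inE; have [->|] := eqVneq e [set a; b]%SET.
- by rewrite h.
- by rewrite /= addbF.
- by rewrite h.
- by rewrite /= addbF.
Qed.

Lemma toggleK (a b : 'I_n) (ab : a != b) : involutive (toggle ab).
Proof.
move=> G; apply: val_inj; apply/setP => e.
have := toggle_edges ab (toggle ab G) e.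
by rewrite (toggle_edges ab G) -addbA addbb addbF.
Qed.

(* Toggling the edge [ab] is a weighted involution that changes the sign of the
   centred edge indicator. *)
Lemma expect_edge0 (a b : 'I_n) (Y : sgraph 'I_n -> R) (ab : a != b) :
  (forall G, Y (toggle ab G) = Y G) ->
  \sum_G gnp p G * (((adj G a b)%:R - p) * Y G) = 0.
Proof.
move=> hY; set S := \sum_G _.
suff : S + S = 0 by move/eqP; rewrite -mulr2n mulrn_eq0 => /eqP.
rewrite {1}/S (reindex_inj (inv_inj (toggleK ab))) /= -big_split /=.
apply: big1 => G _; rewrite hY.
have e2 : #|[set a; b]%SET| == 2%N by rewrite cards2 ab.
rewrite /gnp (bigD1 [set a; b]%SET) //= [in X in _ + X](bigD1 [set a; b]%SET) //=.
rewrite /adj /= [[set a; b]%SET \in edges (toggle ab G)]toggle_edges eqxx addbT.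
rewrite (eq_bigr (fun e => if e \in edges G then p else 1 - p)); last first.
  by move=> e /andP[_ ne]; rewrite (toggle_edges ab) (negPf ne) addbF.
by case: (_ \in edges G) => /=; ring.
Qed.

Lemma expect_le1 (Y : sgraph 'I_n -> R) : (forall G, Y G <= 1) ->
  \sum_G gnp p G * Y G <= 1.
Proof.
move=> hY; rewrite -gnp_sum1; apply: ler_sum => G _.
by rewrite ler_piMr ?gnp_ge0.
Qed.

Lemma adj_toggle (a b x y : 'I_n) (ab : a != b) (G : sgraph 'I_n) :
  [set x; y]%SET != [set a; b]%SET -> adj (toggle ab G) x y = adj G x y.
Proof. by move=> h; rewrite /adj /= (toggle_edges ab) (negPf h) addbF. Qed.

Lemma adj_normr (G : sgraph 'I_n) (a b : 'I_n) : `|(adj G a b)%:R - p| <= 1.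
Proof.
case/andP: p01 => p0 p1; rewrite ler_norml.
by case: (adj G a b) => /=; apply/andP; split; lra.
Qed.

(** Without any of the four coincidences, the pair [ab] differs from the other three pairs, so its
    centred factor is independent of them and the expectation vanishes. Otherwise the trivial bound
    1 suffices. *)
Lemma expect_cycle4 (a a' b b' : 'I_n) :
  \sum_G gnp p G * (((adj G a b)%:R - p) * ((adj G a' b)%:R - p) *
      (((adj G a b')%:R - p) * ((adj G a' b')%:R - p))) <=
  (a == b)%:R + (a == a')%:R + (b == b')%:R + (a == b')%:R.
Proof.
have [bad|] := boolP [|| a == b, a == a', b == b' | a == b'].
  apply: (@le_trans _ _ 1).
    apply: expect_le1 => G; apply: le_trans (ler_norm _) _; rewrite !normrM.
    by rewrite !mulr_ile1 ?mulr_ge0 ?adj_normr.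
  rewrite -!natrD ler1n; move: bad.
  by case: (a == b); case: (a == a'); case: (b == b'); case: (a == b').
rewrite !negb_or => /and4P[ab aa' bb' ab'].
rewrite (negPf ab) (negPf aa') (negPf bb') (negPf ab') /= !addr0.
rewrite le_eqVlt; apply/orP; left; apply/eqP.
under eq_bigr do rewrite -(mulrA (_ - _)).
apply: (expect_edge0 (ab := ab)) => G; rewrite !adj_toggle //.
- apply/eqP => /setP /(_ a); rewrite !inE eqxx /=.
  by rewrite (negPf aa') (negPf ab').
- apply/eqP => /setP /(_ b); rewrite !inE eqxx orbT (negPf bb') orbF.
  by rewrite eq_sym (negPf ab).
- apply/eqP => /setP /(_ a); rewrite !inE eqxx /=.
  by rewrite (negPf aa') (negPf ab).
Qed.

(** Each of the four coincidences leaves three free indices. *)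
Lemma expect_energy :
  \sum_G gnp p G * codegree_energy (fun a b : 'I_n => (adj G a b)%:R - p) <=
  4 * n%:R ^+ 3.
Proof.
have E G : codegree_energy (fun a b : 'I_n => (adj G a b)%:R - p) =
   \sum_a \sum_a' \sum_b \sum_b' (((adj G a b)%:R - p) * ((adj G a' b)%:R - p) *
      (((adj G a b')%:R - p) * ((adj G a' b')%:R - p))).
  apply: eq_bigr => a _; apply: eq_bigr => a' _.
  by rewrite expr2 big_distrlr.
under eq_bigr do rewrite E mulr_sumr.
rewrite exchange_big /=.
have -> : 4 * n%:R ^+ 3 = \sum_(a < n) \sum_(a' < n) \sum_(b < n) \sum_(b' < n)
   ((a == b)%:R + (a == a')%:R + (b == b')%:R + (a == b')%:R) :> R.
  have d1 (x : 'I_n) : \sum_(y < n) (x == y)%:R = 1 :> R.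
    rewrite (bigD1 x) //= eqxx big1 ?addr0 // => y; by rewrite eq_sym => /negPf ->.
  transitivity (\sum_(a < n) \sum_(a' < n) \sum_(b < n)
     ((a == b)%:R * n%:R + (a == a')%:R * n%:R + 1 + 1) : R).
    transitivity (\sum_(a < n) \sum_(a' < n)
       (n%:R + (a == a')%:R * n%:R * n%:R + n%:R + n%:R) : R).
      transitivity (\sum_(a < n) 4 * n%:R ^+ 2 : R).
        by rewrite sumr_const card_ord -[RHS]mulr_natr -mulrA -exprSr.
      apply: eq_bigr => a _; rewrite !big_split /= -!mulr_suml d1 !sumr_const card_ord.
      by rewrite -!(mulr_natr n%:R); ring.
    apply: eq_bigr => a _; apply: eq_bigr => a' _.
    rewrite !big_split /= -!mulr_suml d1 !sumr_const card_ord mul1r.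
    by rewrite (mulr_natr (a == a')%:R).
  apply: eq_bigr => a _; apply: eq_bigr => a' _; apply: eq_bigr => b _.
  by rewrite !big_split /= !d1 !sumr_const card_ord !mulr_natr.
apply: ler_sum => a _; under eq_bigr do rewrite mulr_sumr.
rewrite exchange_big /=; apply: ler_sum => a' _; under eq_bigr do rewrite mulr_sumr.
rewrite exchange_big /=; apply: ler_sum => b _; under eq_bigr do rewrite mulr_sumr.
rewrite exchange_big /=; apply: ler_sum => b' _; exact: expect_cycle4.
Qed.

Lemma gnp_prob_le1 (A : sgraph 'I_n -> Prop) : gnp_prob p A <= 1.
Proof.
rewrite -gnp_sum1 /gnp_prob [X in X <= _]big_mkcond; apply: ler_sum => G _.
by case: ifP => // _; exact: gnp_ge0.
Qed.

Lemma gnp_prob_mono (A B : sgraph 'I_n -> Prop) :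
  (forall G, A G -> B G) -> gnp_prob p A <= gnp_prob p B.
Proof.
move=> AB; rewrite /gnp_prob [X in X <= _]big_mkcond [X in _ <= X]big_mkcond.
apply: ler_sum => G _; case: asboolP => [/AB hB|_]; first by case: asboolP.
by case: ifP => // _; exact: gnp_ge0.
Qed.

(** Markov's inequality for the energy, at the threshold [d ^+ 4 * n%:R ^+ 4] below which it forces
    quasirandomness. *)
Lemma gnp_quasirandom (d : R) : 0 < d -> (0 < n)%N ->
  1 - 4 / (d ^+ 4 * n%:R) <= gnp_prob p (fun G : sgraph 'I_n => quasirandom (adj G) p d).
Proof.
move=> d0 n0; rewrite lerBlDl -lerBlDr.
have nR : 0 < n%:R :> R by rewrite ltr0n.
pose S (G : sgraph 'I_n) := codegree_energy (fun a b : 'I_n => (adj G a b)%:R - p).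
have S0 G : 0 <= S G.
  by apply: sumr_ge0 => a _; apply: sumr_ge0 => a' _; exact: sqr_ge0.
pose t := d ^+ 4 * n%:R ^+ 4; have t0 : 0 < t by rewrite mulr_gt0 ?exprn_gt0.
apply: (@le_trans _ _ (\sum_G gnp p G * S G / t)); last first.
  rewrite -mulr_suml ler_pdivrMr //; apply: le_trans expect_energy _.
  rewrite /t le_eqVlt; apply/orP; left; apply/eqP; field.
  by rewrite !gt_eqF.
rewrite lerBlDr -gnp_sum1 /gnp_prob [X in _ <= _ + X]big_mkcond -big_split /=.
apply: ler_sum => G _; case: asboolP => hG.
  by rewrite lerDr mulr_ge0 ?invr_ge0 ?mulr_ge0 ?gnp_ge0 // ltW.
rewrite addr0 -mulrA ler_peMr ?gnp_ge0 // ler_pdivlMr // mul1r ltW // ltNge.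
apply/negP => hS; apply: hG; apply: energy_quasirandom; first exact: ltW.
by rewrite card_ord.
Qed.

End Expectation.

(** * Graphs *)

Lemma adj_sym (T : finType) (G : sgraph T) : symmetric (adj G).
Proof. by move=> x y; rewrite /adj /= finset.setUC. Qed.

Lemma adj_irr (T : finType) (G : sgraph T) : irreflexive (adj G).
Proof. by move=> x; apply/negP => /adj_neq; rewrite eqxx. Qed.

Lemma set2_eq (T : finType) (a b x y : T) : x != y ->
  ([set a; b]%SET == [set x; y]%SET) = ((a, b) == (x, y)) || ((a, b) == (y, x)).
Proof.
move=> xy; rewrite !xpair_eqE; apply/eqP/orP; last first.
  by case=> /andP[/eqP -> /eqP ->] //; rewrite finset.setUC.
move=> E; have := set21 a b; rewrite E => /set2P[] ax; have := set22 a b;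
  rewrite E => /set2P[] bx; subst a b; rewrite ?eqxx; try by [left | right].
- by move/setP/(_ y): E; rewrite !inE eqxx orbT (eq_sym y) (negPf xy).
- by move/setP/(_ x): E; rewrite !inE eqxx (negPf xy).
Qed.

Lemma sum_adj (T : finType) (G : sgraph T) :
  (\sum_a \sum_b adj G a b = 2 * #|edges G|)%N.
Proof.
transitivity (\sum_a \sum_b \sum_(e in edges G) ([set a; b]%SET == e))%N.
  apply: eq_bigr => a _; apply: eq_bigr => b _; rewrite /adj /=.
  case: (boolP (_ \in _)) => [abG|nab]; last first.
    by rewrite big1 // => e eG; case: eqP => // ab; rewrite ab eG in nab.
  rewrite (bigD1 [set a; b]%SET) //= eqxx big1 // => e /andP[_].
  by rewrite eq_sym => /negPf ->.
under eq_bigr do rewrite exchange_big /=.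
rewrite exchange_big /= mulnC -sum_nat_const; apply: eq_bigr => e eG.
have /eqP /cards2P[x [y [xy ->]]] := card_edge eG.
rewrite pair_bigA /=.
under eq_bigr => t _ do rewrite (set2_eq _ _ xy) -!surjective_pairing.
rewrite (bigD1 (x, y)) //= eqxx (bigD1 (y, x)) /=; last first.
  by rewrite xpair_eqE negb_and eq_sym xy.
by rewrite eqxx orbT big1 // => t /andP[/negPf -> /negPf ->].
Qed.

Lemma isomorphic_sym (T U : finType) (G : sgraph T) (H : sgraph U) :
  isomorphic G H -> isomorphic H G.
Proof.
case=> f [g fK gK] fh; exists g; first by exists f.
by move=> x y; rewrite fh !gK.
Qed.

(** * Graphs on a vertex subset, and embeddings *)

Lemma imset_set2 (T U : finType) (f : T -> U) (x y : T) :
  [set f z | z in [set x; y]%SET]%SET = [set f x; f y]%SET.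
Proof. by rewrite imsetU !imset_set1. Qed.

Lemma adj_induced (T : finType) (G : sgraph T) (W : {set T}) (x y : subvert W) :
  adj (Defs.induced G W) x y = adj G (val x) (val y).
Proof. by rewrite /adj /= inE imset_set2. Qed.

Lemma extend_subproof (T : finType) (W : {set T}) (H : sgraph (subvert W)) :
  [forall e in [set [set val x | x in e]%SET | e : {set subvert W} in edges H]%SET,
     #|e| == 2%N].
Proof.
apply/forall_inP => _ /imsetP[e /card_edge e2 ->].
by rewrite card_imset ?e2 //; exact: val_inj.
Qed.

(** Vertices outside [W] become isolated, so a subgraph on [W] can be compared with [G] on a common
    vertex set. *)
Definition extend (T : finType) (W : {set T}) (H : sgraph (subvert W)) : sgraph T :=
  SGraph (extend_subproof H).

Lemma card_extend (T : finType) (W : {set T}) (H : sgraph (subvert W)) :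
  #|edges (extend H)| = #|edges H|.
Proof. by rewrite card_imset //; apply: imset_inj; exact: val_inj. Qed.

Lemma adj_extend (T : finType) (W : {set T}) (H : sgraph (subvert W)) x y :
  adj (extend H) (val x) (val y) = adj H x y.
Proof.
rewrite /adj /= -imset_set2 mem_imset //.
by apply: imset_inj; exact: val_inj.
Qed.

Lemma adj_extend_in (T : finType) (W : {set T}) (H : sgraph (subvert W)) a b :
  adj (extend H) a b -> a \in W.
Proof.
rewrite /adj /= => /imsetP[e _ E]; have := set21 a b; rewrite E => /imsetP[x _ ->].
exact: valP.
Qed.

Lemma adj_extend_sub (T : finType) (G : sgraph T) (W : {set T})
    (H : sgraph (subvert W)) : subgraph G H -> subrel (adj (extend H)) (adj G).
Proof. by move/forall_inP => h a b; rewrite /adj /= => /imsetP[e /h + ->]. Qed.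

(** [H] is isomorphic to the subgraph induced on the image of [y]. *)
Lemma property_induced (P : graph_family) (T U : finType) (G : sgraph T)
    (H : sgraph U) (y : U -> T) :
  graph_property P -> hereditary P -> P T G -> injective y ->
  (forall a b, adj H a b = adj G (y a) (y b)) -> P U H.
Proof.
move=> isoP herP PG yinj hy.
pose Z := [set y a | a : U]%SET.
pose z a : subvert Z := exist _ (y a) (imset_f y (isT : a \in U)).
apply: (isoP _ _ _ _ _ (herP _ _ Z PG)); apply: isomorphic_sym.
exists z; last by move=> a b; rewrite adj_induced hy.
apply: inj_card_bij; first by move=> a b /(congr1 val) /yinj.
by rewrite card_sig card_imset.
Qed.

(** * Chromatic numbers and cuts by vertex colourings *)

Lemma chromatic_number_colorable (T : finType) (G : sgraph T) :
  colorable G (chromatic_number G).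
Proof. by rewrite /chromatic_number; case: ex_minnP. Qed.

Lemma chromatic_number_le (T : finType) (G : sgraph T) (k : nat) :
  colorable G k -> (chromatic_number G <= k)%N.
Proof. by rewrite /chromatic_number; case: ex_minnP => m _; apply. Qed.

(** A graph colourable with at most one colour is edgeless, hence belongs to [P]. *)
Lemma min_excluded_chromatic_ge2 (P : graph_family) (k : nat) :
  nontrivial P -> min_excluded_chromatic P k -> (2 <= k)%N.
Proof.
case=> Pe _ [[T [G [nG <-]]] _]; rewrite leqNgt; apply/negP => k1; apply: nG.
apply: Pe; apply/setP => e; rewrite inE; apply/negP => eG.
have /eqP /cards2P[x [y [xy E]]] := card_edge eG.
have /existsP[c /forallP /(_ x) /forallP /(_ y) /implyP] := chromatic_number_colorable G.
rewrite /adj /= -E => /(_ eG) /eqP; apply; apply: val_inj.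
have := ltn_ord (c x); have := ltn_ord (c y).
by move: (chromatic_number G) (c x) (c y) k1 => [|[|m]] // [[|?] ?] [[|?] ?].
Qed.

Section Cut.
Variables (T : finType) (C : finType) (G : sgraph T) (c : T -> C).

Lemma cut_subproof :
  [forall e in [set e in edges G | #|[set c x | x in e]%SET| == 2%N]%SET, #|e| == 2%N].
Proof. by apply/forall_inP => e; rewrite inE => /andP[/card_edge ->]. Qed.

Definition cut : sgraph T := SGraph cut_subproof.

Lemma adj_cut a b : adj cut a b = adj G a b && (c a != c b).
Proof. by rewrite /adj /= inE imset_set2 cards2; case: (c a == c b). Qed.

End Cut.

(** Since [ex] ranges over graphs on vertex subsets, a spanning subgraph enters it through the full
    subset. *)
Lemma card_edges_inducedT (T : finType) (G : sgraph T) :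
  #|edges (Defs.induced G [set: T]%SET)| = #|edges G|.
Proof.
have -> : edges G = [set [set val x | x in e]%SET |
    e : {set subvert [set: T]%SET} in edges (Defs.induced G [set: T]%SET)]%SET.
  apply/setP => e; apply/idP/imsetP => [eG|[e' + ->]]; last by rewrite inE.
  have E : e = [set val x | x in [set x : subvert [set: T]%SET | val x \in e]%SET]%SET.
    apply/setP => x; apply/idP/imsetP => [xe|[x' + ->]]; last by rewrite inE.
    by exists (exist _ x (finset.in_setT x)); rewrite ?inE.
  by exists [set x : subvert [set: T]%SET | val x \in e]%SET => //; rewrite inE -E.
by rewrite card_imset //; apply: imset_inj; exact: val_inj.
Qed.

Lemma leq_ex (P : graph_family) (T : finType) (G : sgraph T) (W : {set T})
    (H : sgraph (subvert W)) :
  subgraph G H -> P (subvert W) H -> (#|edges H| <= ex P G)%N.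
Proof.
move=> sub PH; rewrite /ex.
apply: leq_trans (leq_bigmax (F := fun W : {set T} => _) W).
apply: (@leq_bigmax_cond _ _ (fun H : sgraph (subvert W) => #|edges H|)).
by rewrite sub; apply/asboolP.
Qed.

(** First moment: for a uniformly random colouring, recolouring one end of an edge separates it from
    the other end for [r] of the [r.+1] colours. *)
Lemma exists_cut (R : realFieldType) (T : finType) (e : rel T) (r : nat) :
  irreflexive e ->
  exists c : {ffun T -> 'I_r.+1},
    r%:R / r.+1%:R * (\sum_a \sum_b (e a b)%:R : R) <=
    \sum_a \sum_b (e a b && (c a != c b))%:R.
Proof.
move=> eirr; set D : R := \sum_a _.
pose F (c : {ffun T -> 'I_r.+1}) : R := \sum_a \sum_b (e a b && (c a != c b))%:R.
have S : r.+1%:R * \sum_c F c = \sum_(c : {ffun T -> 'I_r.+1}) r%:R * D.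
  under eq_bigr do rewrite /F; rewrite exchange_big mulr_sumr.
  under [RHS]eq_bigr do rewrite /D mulr_sumr.
  rewrite [RHS]exchange_big /=; apply: eq_bigr => a _.
  rewrite exchange_big mulr_sumr.
  under [RHS]eq_bigr do rewrite mulr_sumr.
  rewrite [RHS]exchange_big /=; apply: eq_bigr => b _.
  case eab: (e a b); last by rewrite !big1 ?mulr0 // => c _; rewrite mulr0.
  have ab : a != b by apply: contraTneq eab => ->; rewrite eirr.
  transitivity (#|'I_r.+1|%:R * \sum_(c : {ffun T -> 'I_r.+1}) (c a != c b)%:R : R).
    by rewrite card_ord.
  rewrite -(sum_upd a); apply: eq_bigr => c _ /=.
  under eq_bigr => i _ do rewrite !ffunE eqxx (eq_sym b) (negPf ab).
  rewrite mulr1 -natr_sum; congr (_%:R).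
  transitivity #|predC1 (c b)|; last by rewrite cardC1 card_ord.
  rewrite -sum1_card [RHS]big_mkcond.
  by apply: eq_bigr => i _; rewrite !inE; case: (i == c b).
apply/existsP; apply: contraT; rewrite negb_exists => /forallP h.
have : \sum_c F c < \sum_(c : {ffun T -> 'I_r.+1}) r%:R / r.+1%:R * D.
  pose c0 : {ffun T -> 'I_r.+1} := [ffun=> ord0].
  rewrite (bigD1 c0) //= [X in _ < X](bigD1 c0) //=.
  apply: ltr_leD; first by rewrite ltNge h.
  by apply: ler_sum => c _; rewrite leNgt; apply: contra (h c); exact: ltW.
have -> : \sum_(c : {ffun T -> 'I_r.+1}) r%:R / r.+1%:R * D = \sum_c F c.
  apply: (mulfI (x := r.+1%:R)); first by rewrite pnatr_eq0.
  rewrite S mulr_sumr; apply: eq_bigr => c _; field.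
  by rewrite nat1r pnatr_eq0.
by rewrite ltxx.
Qed.

(** * Asymptotics *)

Local Open Scope classical_set_scope.
Local Open Scope ring_scope.

Lemma sum_adjR (R : realFieldType) (T : finType) (G : sgraph T) :
  \sum_a \sum_b (adj G a b)%:R = 2 * #|edges G|%:R :> R.
Proof.
rewrite -natrM -sum_adj natr_sum; apply: eq_bigr => a _.
by rewrite natr_sum.
Qed.

(** A cut into [r.+1] classes has chromatic number below [r.+2], so it belongs to [P]. *)
Lemma ex_lower (R : realFieldType) (P : graph_family) (r : nat) (T : finType)
    (G : sgraph T) :
  min_excluded_chromatic P r.+2 ->
  r%:R / r.+1%:R * #|edges G|%:R <= (ex P G)%:R :> R.
Proof.
case=> _ minP; have [c hc] := @exists_cut R T (adj G) r (@adj_irr _ G).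
have : 2 * (r%:R / r.+1%:R * #|edges G|%:R) <= 2 * #|edges (cut G c)|%:R :> R.
  rewrite mulrCA -!sum_adjR; apply: le_trans hc _.
  by apply: ler_sum => a _; apply: ler_sum => b _; rewrite adj_cut.
rewrite ler_pM2l // => /le_trans; apply; rewrite ler_nat -card_edges_inducedT.
apply: leq_ex.
  by apply/forall_inP => e; rewrite !inE => /andP[].
apply: contrapT => /minP; apply/negP; rewrite -ltnNge ltnS.
apply: chromatic_number_le; apply/existsP.
exists [ffun x => c (val x)]; apply/forallP => x; apply/forallP => y.
by apply/implyP; rewrite adj_induced adj_cut !ffunE => /andP[].
Qed.

(** A subgraph with more edges would contain an induced copy of an excluded graph [H] of chromatic
    number [r.+2], contrary to heredity. *)
Lemma ex_upper (R : archiRealFieldType) (P : graph_family) (r : nat) (p eta : R) :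
  graph_property P -> hereditary P -> min_excluded_chromatic P r.+2 ->
  0 < p < 1 -> 0 < eta ->
  exists d : R, 0 < d /\ exists n0 : nat,
  forall (T : finType) (G : sgraph T), (n0 <= #|T|)%N ->
    quasirandom (adj G) p d ->
    2 * (ex P G)%:R <= (r%:R / r.+1%:R + eta) * p * #|T|%:R ^+ 2.
Proof.
move=> isoP herP [[U [H [nH chiH]]] _] p01 eta0.
have := chromatic_number_colorable H; rewrite chiH => /existsP[c hc].
have hcol a b : adj H a b -> c a != c b.
  by have /forallP/(_ a)/forallP/(_ b)/implyP := hc.
have [d [d0 [n0 hd]]] := induced_embedding p01 eta0 (adj_sym H) hcol.
exists d; split=> //; exists n0 => T G hT qr.
set B := _ * _ * _; have /andP[p0 p1] := p01.
have B0 : 0 <= B.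
  by rewrite !mulr_ge0 ?sqr_ge0 ?addr_ge0 ?(ltW p0) ?(ltW eta0) // invr_ge0.
pose K m := 2 * m%:R <= B.
have KM a b : K a -> K b -> K (maxn a b) by rewrite /K /maxn; case: ifP.
have K0 : K 0%N by rewrite /K mulr0.
apply: (big_ind K) => // W _; apply: (big_ind K) => // H0 /andP[sub /asboolP PH0].
rewrite /K leNgt; apply/negP => /ltW.
rewrite -card_extend -sum_adjR => hB.
have [x [xinj hx hxW]] := hd T (adj G) (adj (extend H0)) hT (adj_sym G)
  (@adj_irr _ G) (adj_sym _) (adj_extend_sub sub) qr hB.
(* Vertices outside [W] are isolated in [extend H0], whereas every image has a neighbour there. *)
have xW a : x a \in W by have [v /adj_extend_in] := hxW a.
pose y a : subvert W := exist _ (x a) (xW a).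
apply: nH; apply: (property_induced (y := y) isoP herP PH0).
  by move=> a b /(congr1 val) /xinj.
by move=> a b; rewrite hx -adj_extend.
Qed.

Lemma quasirandomW (R : realFieldType) (V : finType) (r : rel V) (p d d' : R) :
  d <= d' -> quasirandom r p d -> quasirandom r p d'.
Proof.
by move=> dd h A B; apply: le_trans (h A B) _; rewrite ler_wpM2r ?sqr_ge0.
Qed.

Lemma bin2R (R : realFieldType) (n : nat) :
  2 * 'C(n, 2)%:R = n%:R * (n%:R - 1) :> R.
Proof.
rewrite -natrM mul2n bin2; case: n => [|n]; first by rewrite mul0r.
have -> : n.+1%:R - 1 = n%:R :> R by rewrite -natr1 addrK.
rewrite -natrM; congr (_%:R); rewrite -[RHS]odd_double_half.
by rewrite oddM /= andNb.
Qed.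

(** * Concentration, and a single vanishing error term *)

Section Asymptotics.
Variables (R : realType) (p : R).
Hypothesis p01 : 0 < p < 1.

Lemma ex_concentration (P : graph_family) (r : nat) :
  graph_property P -> hereditary P -> min_excluded_chromatic P r.+2 ->
  forall eps rho : R, 0 < eps -> 0 < rho ->
  exists N : nat, forall n, (N <= n)%N ->
    1 - rho <= gnp_prob p (fun G : sgraph 'I_n =>
      `|(ex P G)%:R / (p * 'C(n, 2)%:R) - r%:R / r.+1%:R| < eps).
Proof.
move=> isoP herP minP eps rho eps0 rho0; have /andP[p0 p1] := p01.
set tau : R := r%:R / r.+1%:R.
have tau0 : 0 <= tau by rewrite divr_ge0.
have tau1 : tau <= 1 by rewrite ler_pdivrMr ?ltr0n // mul1r ler_nat.
have eta0 : 0 < eps / 2 by rewrite divr_gt0.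
have [d1 [d10 [n0 hd1]]] := ex_upper isoP herP minP p01 eta0.
(* The bound [d1] serves the upper estimate, [p / 2] keeps [p - d] positive, and [eps * p / 2]
   controls the deviation of the edge count in the lower estimate. *)
pose d := Num.min d1 (Num.min (p / 2) (eps * p / 2)).
have d0 : 0 < d by rewrite !lt_min d10 !divr_gt0 ?mulr_gt0.
have [dd1 dp deps] : [/\ d <= d1, d <= p / 2 & d <= eps * p / 2].
  by rewrite !ge_min !lexx ?orbT.
(* [N1] brings the failure probability below [rho]; [N2] absorbs the difference between [n ^ 2] and
   [n * (n - 1)]. *)
pose N1 := Num.bound (4 / (d ^+ 4 * rho)).
pose N2 := Num.bound (2 * (1 + eps) / eps).
exists (maxn (maxn n0 N1) (maxn N2.+1 2)) => n.
rewrite !geq_max => /andP[/andP[nn0 nN1] /andP[nN2 n2]].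
have nR : 2 <= n%:R :> R by rewrite ler_nat.
have hN1 : 4 / (d ^+ 4 * rho) < n%:R.
  apply: lt_le_trans (archi_boundP _) _; last by rewrite ler_nat.
  by rewrite divr_ge0 // mulr_ge0 ?exprn_ge0 ?ltW.
have hN2 : 2 * (1 + eps) / eps < n%:R - 1.
  apply: lt_le_trans (archi_boundP _) _.
    by rewrite divr_ge0 ?mulr_ge0 ?addr_ge0 ?ltW.
  by rewrite lerBrDr natr1 ler_nat.
have n0' : (0 < n)%N by exact: ltnW.
have nR0 : 0 < n%:R :> R by rewrite ltr0n.
apply: (@le_trans _ _ (1 - 4 / (d ^+ 4 * n%:R))).
  rewrite lerD2l lerN2 ler_pdivrMr ?mulr_gt0 ?exprn_gt0 //.
  move: hN1; rewrite ltr_pdivrMr ?mulr_gt0 ?exprn_gt0 // => /ltW; lra.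
apply: le_trans (gnp_quasirandom p01 d0 n0') _; apply: gnp_prob_mono => // G qr.
have := hd1 _ G _ (quasirandomW dd1 qr); rewrite card_ord => /(_ _) up.
have {}up : 2 * (ex P G)%:R <= (tau + eps / 2) * p * n%:R ^+ 2 by exact: up.
have low : tau * ((p - d) * n%:R ^+ 2) <= 2 * (ex P G)%:R.
  have := qr finset.setT finset.setT; rewrite cardsT card_ord.
  under eq_bigl do rewrite inE; under eq_bigr do under eq_bigl do rewrite inE.
  rewrite sum_adjR ler_norml => /andP[low _].
  have := @ex_lower R P r _ G minP; rewrite -/tau => /(ler_wpM2l (ler0n R 2)) H.
  apply: le_trans H; rewrite [leRHS]mulrCA ler_wpM2l //; move: low; rewrite expr2; lra.
set E : R := (ex P G)%:R in up low *.
have nn : 0 < n%:R * (n%:R - 1) :> R by rewrite mulr_gt0 // subr_gt0; lra.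
have -> : E / (p * 'C(n, 2)%:R) = 2 * E / (p * (n%:R * (n%:R - 1))).
  have c0 : 'C(n, 2)%:R != 0 :> R by rewrite pnatr_eq0 -lt0n bin_gt0.
  by rewrite -bin2R; field; rewrite c0 gt_eqF.
have pnn : 0 < p * (n%:R * (n%:R - 1)) by rewrite mulr_gt0.
rewrite ltr_norml; apply/andP; split; [rewrite ltrBrDr | rewrite ltrBlDr].
  rewrite ltr_pdivlMr //; apply: lt_le_trans low.
  have taud : tau * d <= d by rewrite ler_piMl // ltW.
  have tp : 0 <= tau * (p - d) by rewrite mulr_ge0 //; lra.
  apply: (@lt_le_trans _ _ (tau * (p - d) * (n%:R * (n%:R - 1)))).
    have epsp : 0 < eps * p by rewrite mulr_gt0.
    by rewrite mulrA ltr_pM2r //; lra.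
  by rewrite mulrA ler_wpM2l // expr2 ler_wpM2l //; lra.
rewrite ltr_pdivrMr //; apply: le_lt_trans up _.
move: hN2; rewrite ltr_pdivrMr // => hN2.
rewrite -mulrA mulrCA [ltRHS]mulrCA ltr_pM2l // expr2 mulrCA [ltRHS]mulrCA ltr_pM2l //.
lra.
Qed.

(** A diagonal argument turns concentration at every fixed scale into one error term that tends to
    zero uniformly over all graphs. *)
Lemma diagonal_error (X : forall n, sgraph 'I_n -> R) :
  (forall eps rho : R, 0 < eps -> 0 < rho ->
    exists N : nat, forall n, (N <= n)%N ->
      1 - rho <= gnp_prob p (fun G => `|X n G| < eps)) ->
  exists o : forall n : nat, sgraph 'I_n -> R,
    (forall eps : R, 0 < eps ->
       \forall n \near \oo, forall G : sgraph 'I_n, `|o n G| < eps) /\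
    whp p (fun n G => o n G = X n G).
Proof.
move=> hX.
pose good n j := 1 - j.+1%:R^-1 <= gnp_prob p (fun G : sgraph 'I_n => `|X n G| < j.+1%:R^-1).
(* At scale 1 the required probability is 0, so the maximum defining [J] is over a nonempty set. *)
have good0 n : good n 0%N.
  rewrite /good invr1 subrr /gnp_prob; apply: sumr_ge0 => G _; exact: gnp_ge0.
(* The finest scale [1/(j+1)] at which [X n] is already concentrated. *)
pose J n := (\max_(j < n.+1 | good n j) j)%N.
have goodJ n : good n (J n).
  suff [i gi ->] : exists2 i : 'I_n.+1, good n i & J n = i by [].
  have [|i gi E] := @eq_bigmax_cond 'I_n.+1 (fun j => good n j) (fun j => j : nat).
    by apply/card_gt0P; exists ord0; exact: good0.
  by exists i; [exact: gi | exact: E].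
have Jinf j : exists N, forall n, (N <= n)%N -> (j <= J n)%N.
  have e0 : 0 < j.+1%:R^-1 :> R by rewrite invr_gt0 ltr0n.
  have [N hN] := hX _ _ e0 e0; exists (maxn N j) => n; rewrite geq_max => /andP[Nn jn].
  have jn1 : (j < n.+1)%N by [].
  apply: (@leq_bigmax_cond _ (fun j : 'I_n.+1 => good n j) (fun j => j : nat)
    (Ordinal jn1)).
  exact: hN.
pose eps n : R := (J n).+1%:R^-1.
have eps0 n : 0 < eps n by rewrite invr_gt0 ltr0n.
have epslim e : 0 < e -> exists N, forall n, (N <= n)%N -> eps n < e.
  move=> e0; have [N hN] := Jinf (Num.bound e^-1); exists N => n /hN h.
  rewrite /eps invf_plt ?posrE ?ltr0n //.
  apply: lt_le_trans (archi_boundP _) _; first by rewrite invr_ge0 ltW.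
  by rewrite ler_nat; exact: leqW.
(* Truncation makes the error small for every graph; it agrees with [X n] off an event of
   probability at most [eps n]. *)
exists (fun n G => if `|X n G| < eps n then X n G else 0); split.
  move=> e e0; have [N hN] := epslim e e0; exists N => // n /= /hN h G.
  by case: ifP => [/lt_trans|_]; [apply | rewrite normr0].
apply/cvgrPdist_lt => e e0; have [N hN] := epslim e e0; exists N => // n /= /hN h.
rewrite ger0_norm ?subr_ge0 ?gnp_prob_le1 // ltrBlDl -ltrBlDr.
apply: (@lt_le_trans _ _ (1 - eps n)); first by rewrite ltrD2l ltrN2.
apply: le_trans (goodJ n) _; apply: gnp_prob_mono => // G.
by rewrite -/(eps n) => ->.
Qed.

End Asymptotics.

Unset Implicit Arguments.

Theorem theorem1p1 (R : realType) (P : graph_family) (k : nat)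
    (P_property : graph_property P) (P_hereditary : hereditary P)
    (P_nontrivial : nontrivial P) (kP : min_excluded_chromatic P k) :
  (2 <= k)%N /\
  forall p : R, 0 < p -> p < 1 ->
    exists o : forall n : nat, sgraph 'I_n -> R,
      (forall eps : R, 0 < eps ->
         \forall n \near \oo, forall G : sgraph 'I_n, `|o n G| < eps) /\
      whp p (fun (n : nat) (G : sgraph 'I_n) =>
        (ex P G)%:R = (1 - 1 / (k%:R - 1) + o n G) * p * 'C(n, 2)%:R).
Proof.
have kge2 := min_excluded_chromatic_ge2 P_nontrivial kP; split=> // p p0 p1.
case: k kge2 kP => [|[|r]] // _ kP.
have p01 : 0 < p < 1 by rewrite p0.
have [err [err0 herr]] := diagonal_error p01 (ex_concentration p01 P_property P_hereditary kP).
exists err; split=> //.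
apply/cvgrPdist_lt => e e0; move/cvgrPdist_lt/(_ e e0): herr => [N _ hN].
(* From [n = 2] on, [p * 'C(n, 2)%:R] is nonzero and the normalised identity can be multiplied
   out. *)
exists (maxn N 2) => // n /=; rewrite geq_max => /andP[/hN h n2].
apply: le_lt_trans h.
rewrite !ger0_norm ?subr_ge0 ?gnp_prob_le1 // lerD2l lerN2.
apply: gnp_prob_mono => // G ->.
have -> : 1 - 1 / (r.+2%:R - 1) = r%:R / r.+1%:R :> R.
  by rewrite -[r.+2%:R]natr1 addrK -natr1; field; rewrite natr1 pnatr_eq0.
rewrite addrC subrK -mulrA divfK //.
by rewrite mulf_neq0 ?(gt_eqF p0) // pnatr_eq0 -lt0n bin_gt0.
Qed.
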